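(* Let $\alpha\in(0,1)$. In the model described in the context (including the $\phi$-mixing, boundedness/moment and sampling assumptions (A1), (A2), (A3) listed there), if $n\geqslant\max(d,\tau)$, then with probability larger than $1-\alpha$, $$\|\widehat{\mathbf\Theta}_{k,\tau}-\mathbf\Theta^0\|_{\mathcal F,\Pi}^2\leqslant 3\min_{\mathbf T\in\mathcal S_{k,\tau}}\|(\mathbf T-\mathbf T^0)\mathbf\Lambda\|_{\mathcal F,\Pi}^2+\mathfrak c\left[k(d+\tau)\frac{\log(n)}{n}+\frac1n\log\left(\frac4\alpha\right)\right],$$ where $\mathfrak c$ is a constant depending only on $\mathfrak m_0,\mathfrak v_\xi,\mathfrak c_\xi,\mathfrak m_\varepsilon,\mathfrak m_{\mathbf\Lambda},\Phi_\varepsilon$ and $\mathfrak c_\Pi$.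
   Context: Model. Let $d,T\in\mathbb N^*$, $\tau\in\{1,\dots,T\}$, $n\in\{1,\dots,dT\}$ and $k\in\{1,\dots,d\wedge T\}$. $\mathcal M_{p,q}(\mathbb K)$ is the set of $p\times q$ matrices over $\mathbb K$, and $\langle\mathbf A,\mathbf B\rangle_{\mathcal F}=\mathrm{trace}(\mathbf A^*\mathbf B)=\sum_{j,t}\mathbf A_{j,t}\mathbf B_{j,t}$ on $\mathcal M_{d,T}(\mathbb R)$. One observes $\mathbf X_1,\dots,\mathbf X_n$ and $$Y_i=\mathrm{trace}(\mathbf X_i^*\mathbf M)+\xi_i,\quad i=1,\dots,n,\qquad \mathbf M=\mathbf\Theta^0+\varepsilon,\qquad\mathbf\Theta^0=\mathbf T^0\mathbf\Lambda.$$ Here $\mathbf X_1,\dots,\mathbf X_n$ are i.i.d. random matrices with common distribution $\Pi$ on $\mathcal X=\{e_{\mathbb R^d}(j)e_{\mathbb R^T}(t)^*:1\leqslant j\leqslant d,\ 1\leqslant t\leqslant T\}$ (with $e_{\mathbb R^p}(j)$ the $j$-th canonical basis vector of $\mathbb R^p$); $\xi_1,\dots,\xi_n$ are i.i.d. centered real random variables with standard deviation $\sigma_\xi>0$; $\varepsilon$ is a $d\times T$ real random matrix with i.i.d. centered rows $\varepsilon_{1,.},\dots,\varepsilon_{d,.}$; the families $(\mathbf X_i)_i$, $(\xi_i)_i$ and $\varepsilon$ are mutually independent. $\mathbf\Lambda\in\mathcal M_{\tau,T}(\mathbb C)$ is known and deterministic (the products $\mathbf T\mathbf\Lambda$ appearing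 below are real matrices), and $\mathfrak m_{\mathbf\Lambda}:=\sup_{j,t}|\mathbf\Lambda_{j,t}|$. $\mathfrak m_{\mathbf\Lambda}(\tau)$ is a finite number with $$1\vee\sup_{\mathbf T\in\mathcal M_{d,\tau}(\mathbb R),\,\mathbf T\neq0}\frac{\sup_{j,t}|(\mathbf T\mathbf\Lambda)_{j,t}|}{\sup_{j,\ell}|\mathbf T_{j,\ell}|}\leqslant\mathfrak m_{\mathbf\Lambda}(\tau)<\infty.$$ $\mathbf T^0\in\mathcal M_{d,\tau}(\mathbb R)$ is unknown, deterministic, of rank $k$, with $\sup_{j,t}|\mathbf T^0_{j,t}|\leqslant\mathfrak m_0/\mathfrak m_{\mathbf\Lambda}(\tau)$, $\mathfrak m_0>0$. Estimator. $\mathcal M_{d,k,\tau}$ is the set of products $\mathbf U\mathbf V$ with $\mathbf U\in\mathcal M_{d,k}(\mathbb R)$, $\mathbf V\in\mathcal M_{k,\tau}(\mathbb R)$ whose entries are all bounded in absolute value by $\sqrt{\mathfrak m_0/(k\,\mathfrak m_{\mathbf\Lambda}(\tau))}$. $\mathcal S_{k,\tau}$ is a given subset of $\mathcal M_{d,k,\tau}$ (the minima over $\mathcal S_{k,\tau}$ written here are taken to exist). With $r_n(\mathbf A)=\frac1n\sum_{i=1}^n(Y_i-\langle\mathbf X_i,\mathbf A\rangle_{\mathcal F})^2$, set $\widehat{\mathbf\Theta}_{k,\tau}=\widehat{\mathbf T}_{k,\tau}\mathbf\Lambda$ where $\widehat{\mathbf T}_{k,\tau}\in\arg\min_{\mathbf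 T\in\mathcal S_{k,\tau}}r_n(\mathbf T\mathbf\Lambda)$. Norm. $\|\mathbf A\|_{\mathcal F,\Pi}^2=\int\langle X,\mathbf A\rangle_{\mathcal F}^2\,\Pi(dX)$ for $\mathbf A\in\mathcal M_{d,T}(\mathbb R)$ (for random $\mathbf A$ it is evaluated pointwise). Mixing coefficients. For $\sigma$-algebras $\mathcal A,\mathcal B$, $\phi(\mathcal A,\mathcal B)=\sup\{|\mathbb P(B)-\mathbb P(B|A)|:(A,B)\in\mathcal A\times\mathcal B,\ \mathbb P(A)\neq0\}$; for a process $Z=(Z_t)_{t\in\mathbb Z}$, $\phi_Z(i)=\sup_{t\in\mathbb Z}\phi(\sigma(Z_h,h\leqslant t),\sigma(Z_\ell,\ell\geqslant t+i))$. Assumptions. (A1) The rows of $\varepsilon$ are i.i.d., and there is a process $(\varepsilon_t)_{t\in\mathbb Z}$, with mixing coefficients $\phi_\varepsilon(i)$, such that each row $\varepsilon_{j,.}$ has the same distribution as $(\varepsilon_1,\dots,\varepsilon_T)$ and $\Phi_\varepsilon:=1+\sum_{i=1}^T\phi_\varepsilon(i)^{1/2}<\infty$. (A2) There is a deterministic $\mathfrak m_\varepsilon>0$ with $\sup_{j,t}|\varepsilon_{j,t}|\leqslant\mathfrak m_\varepsilon$, and there are deterministic $\mathfrak c_\xi,\mathfrak v_\xi>0$ with $\sup_i\mathbb E(\xi_i^2)\leqslant\mathfrak v_\xi$ and $\sup_i\mathbb E(|\xi_i|^q)\leqslant\mathfrak v_\xi\mathfrak c_\xi^{q-2}q!/2$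 for every integer $q\geqslant3$. (A3) There is $\mathfrak c_\Pi>0$ with $\Pi(\{e_{\mathbb R^d}(j)e_{\mathbb R^T}(t)^*\})\leqslant\mathfrak c_\Pi/(dT)$ for all $(j,t)\in\{1,\dots,d\}\times\{1,\dots,T\}$. *)

(* Defs.v *)
From HB Require Import structures.
From mathcomp Require Import all_boot all_order all_algebra.
From mathcomp Require Import all_classical all_reals all_analysis.
From mathcomp Require Import complex.
Set Implicit Arguments.
Unset Strict Implicit.
Unset Printing Implicit Defensive.
Import Order.TTheory GRing.Theory Num.Theory.
Import numFieldNormedType.Exports.
Local Open Scope classical_set_scope.
Local Open Scope ring_scope.

(* sigma(f_i, i in D), as a set of subsets of the common domain *)
Definition sigma_family {I aT : Type} {d} {rT : semiRingOfSetsType d}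
    (D : set I) (f : I -> aT -> rT) : set (set aT) :=
  <<s \bigcup_(i in D) preimage_set_system setT (f i) measurable >>.

(* Matrices carry the sigma-algebra generated by the entries; over R this is
   the Borel sigma-algebra. *)
Definition measure_matrix_display : measure_display -> measure_display.
Proof. exact. Qed.

Section measurable_matrix.
Context {d} {T : measurableType d} {m n : nat}.

Let entries : 'I_m * 'I_n -> 'M[T]_(m, n) -> T := fun ij A => A ij.1 ij.2.

Let mx_set0 : sigma_family setT entries set0.
Proof. exact: sigma_algebra0. Qed.

Let mx_setC A : sigma_family setT entries A -> sigma_family setT entries (~` A).
Proof. by move=> mA; rewrite -setTD; exact: sigma_algebraCD. Qed.

Let mx_bigcup (F : (set 'M[T]_(m, n))^nat) :
  (forall i, sigma_family setT entries (F i)) ->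
  sigma_family setT entries (\bigcup_i F i).
Proof. exact: sigma_algebra_bigcup. Qed.

#[warnings="-redundant-canonical-projection"]
HB.instance Definition _ := @isMeasurable.Build (measure_matrix_display d)
  'M[T]_(m, n) (sigma_family setT entries) mx_set0 mx_setC mx_bigcup.

End measurable_matrix.

Section probability.
Context {R : realType} {d} {Omega : measurableType d} (P : probability Omega R).

Definition mutual_independence {I : finType} (F : I -> set (set Omega)) : Prop :=
  forall (J : {set I}) (E : I -> set Omega),
    (forall i, i \in J -> F i (E i)) ->
    fine (P (\bigcap_(i in [set` J]) E i)) = \prod_(i in J) fine (P (E i)).

Definition independent_rvs {I : finType} {d'} {T' : measurableType d'}
    (X : I -> Omega -> T') : Prop :=
  mutual_independence (fun i => preimage_set_system setT (X i) measurable).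

(* The real-valued sup is over a nonempty subset of [0, 1] as soon as both
   arguments are sub-sigma-algebras. *)
Definition phi_coef (A B : set (set Omega)) : R :=
  sup [set x | exists E F, [/\ A E, B F, P E != 0%E &
    x = `|fine (P F) - fine (P (F `&` E)) / fine (P E)|]].

Definition phi_mixing (Z : int -> Omega -> R) (i : nat) : R :=
  sup (range (fun t : int =>
    phi_coef (sigma_family [set h | h <= t] Z)
             (sigma_family [set l | t + i%:Z <= l] Z))).

Definition Phi_mixing (Z : int -> Omega -> R) (T : nat) : R :=
  1 + \sum_(1 <= i < T.+1) Num.sqrt (phi_mixing Z i).

End probability.

Definition same_law {R : realType} {d1 d2 d'} {Omega1 : measurableType d1}
    {Omega2 : measurableType d2} {T' : measurableType d'}
    (P1 : probability Omega1 R) (P2 : probability Omega2 R)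
    (X : Omega1 -> T') (Y : Omega2 -> T') : Prop :=
  forall B, measurable B -> P1 (X @^-1` B) = P2 (Y @^-1` B).

Definition argmin {R : realType} {T : Type} (S : set T) (f : T -> R) : set T :=
  [set x | S x /\ forall y, S y -> f x <= f y].

Section model.
Context {R : realType} {d T : nat}.

Definition frob (A B : 'M[R]_(d, T)) : R := \tr (A^T *m B).

(* the set of the matrices e_j e_t^* *)
Definition sampling_set : set 'M[R]_(d, T) :=
  [set X | exists j t, X = delta_mx j t].

Definition normFPi2 (Pi : probability 'M[R]_(d, T) R) (A : 'M[R]_(d, T)) : R :=
  \int[Pi]_X (frob X A) ^+ 2.

Definition observation (M X : 'M[R]_(d, T)) (xi : R) : R := \tr (X^T *m M) + xi.

Definition empirical_risk {n : nat} (X : 'I_n -> 'M[R]_(d, T)) (Y : 'I_n -> R)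
    (A : 'M[R]_(d, T)) : R :=
  n%:R^-1 * \sum_(i < n) (Y i - frob (X i) A) ^+ 2.

End model.

Section factorization.
Context {R : realType} {tau T : nat} (Lambda : 'M[R[i]]_(tau, T)).

Definition mul_cplx {d : nat} (A : 'M[R]_(d, tau)) : 'M[R[i]]_(d, T) :=
  map_mx (real_complex R) A *m Lambda.

(* A Lambda as a real matrix; meaningful when mul_cplx A has real entries *)
Definition mul_real {d : nat} (A : 'M[R]_(d, tau)) : 'M[R]_(d, T) :=
  map_mx (@complex.Re R) (mul_cplx A).

End factorization.

(* mx_norm is the maximum of the absolute values of the entries, so this is the
   maximal modulus of the entries of a complex matrix *)
Definition mx_normC {R : realType} {m n : nat} (A : 'M[R[i]]_(m, n)) : R :=
  mx_norm (map_mx (@ComplexField.Normc.normc R) A).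

(* the quantity that m_Lambda(tau) has to dominate *)
Definition amplification {R : realType} {tau T : nat} (d : nat)
    (Lambda : 'M[R[i]]_(tau, T)) : \bar R :=
  Order.max 1%E (ereal_sup [set (mx_normC (mul_cplx Lambda A) / mx_norm A)%:E |
                      A in [set A : 'M[R]_(d, tau) | A != 0]]).

Definition factor_class {R : realType} (d k tau : nat) (b : R) :
    set 'M[R]_(d, tau) :=
  [set A | exists (U : 'M[R]_(d, k)) (V : 'M[R]_(k, tau)),
    [/\ A = U *m V, forall j l, `|U j l| <= b & forall l t, `|V l t| <= b]].
Arguments factor_class {R} d k tau b _.

(* Main.v *)
Require Import Defs.
From HB Require Import structures.
From mathcomp Require Import all_boot all_order all_algebra.
From mathcomp Require Import all_classical all_reals all_analysis.
From mathcomp Require Import measurable_realfun complex ring lra zify.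
Set Implicit Arguments.
Unset Strict Implicit.
Unset Printing Implicit Defensive.
Import Order.TTheory GRing.Theory Num.Theory.
Import numFieldNormedType.Exports.
Local Open Scope classical_set_scope.
Local Open Scope ring_scope.

(* With D = (T - T0) Lambda, the risk difference r_n(T Lambda) - r_n(Theta0) is
   the mean of <X_i,D>^2 - 2 (<X_i,eps> + xi_i) <X_i,D>.  Integrating out the X_i
   and the xi_i given eps, and then eps, bounds the Laplace transform of the sum
   at +-s by exp(n (+-s |D|^2 + K s^2 |D|^2)), |.| being the norm of L^2(Pi): the
   cross term left after the X_i is linear in eps, with coefficients of order
   s n Pi_jt D_jt = O(s D_jt), so that its exponential moment is controlled by
   Phi_eps and n Pi_jt <= c_Pi.  For K s <= 1/2 this compares the empirical and
   the true excess risks within factors 1/2 and 3/2, whose quotient is the 3 of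
   the statement.  The estimator is reached through a net obtained by cutting
   the cube of the factors (U, V) into (n+1)^(k(d+tau)) cells, and a single
   Markov inequality is applied to the average over the net plus two further
   exponentials. *)

(** * Integrals of products of independent factors *)

(** The noise [eps] is shared by all observations, since each [X i] only selects an entry of it. The
    summands of the excess loss are therefore not independent, and a Bernstein inequality for the
    whole sum is out of reach: independence is exploited for [X] and [xi] with [eps] frozen, mixing
    for what remains. No conditional expectation is formed; conditioning is replaced by inequalities
    tested on events, which [le_integral_mul_comp] transfers to nonnegative functions. Replacing the
    estimator by a net point changes its loss by a constant plus O(1/n) times sum |xi_i|, and the
    xi_i are unbounded. The two further exponentials thus concern the oracle [Tstar], at +s, and sum
    |xi_i|. Each of the three terms is normalised to have mean at most 1, so that their sum reaches
    4/alpha with probability at most 3 alpha/4: this is the origin of log(4/alpha) and of the strict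
    inequality. *)

Section comparison.
Local Open Scope ereal_scope.
Context {R : realType} {d d'} {T : measurableType d} {T' : measurableType d'}.
Variable mu : {measure set T -> \bar R}.

Import HBNNSimple.

Lemma integral_mul_nnsfun_comp (W : T -> \bar R) (Y : T -> T')
    (f : {nnsfun T' >-> R}) :
  measurable_fun setT W -> (forall w, 0 <= W w) -> measurable_fun setT Y ->
  \int[mu]_w (W w * (f (Y w))%:E) =
  \sum_(k \in range f) k%:E * \int[mu]_(w in Y @^-1` (f @^-1` [set k])) W w.
Proof.
move=> mW W0 mY.
have mYf k : measurable (Y @^-1` (f @^-1` [set k])).
  by rewrite -[X in measurable X]setTI; apply: mY => //; exact: measurable_funPTI.
transitivity (\int[mu]_w \sum_(k \in range f)
    (k%:E * (W \_ (Y @^-1` (f @^-1` [set k]))) w)).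
  apply: eq_integral => w _; rewrite fimfunE.
  rewrite -fsumEFin// muleC ge0_mule_fsuml; last first.
    by move=> k; rewrite nnfun_muleindic_ge0.
  apply: eq_fsbigr => k _; rewrite EFinM -muleA; congr (_ * _).
  rewrite patchE indicE.
  have -> : (w \in Y @^-1` (f @^-1` [set k])) = (Y w \in f @^-1` [set k]).
    by apply/idP/idP; rewrite !inE.
  by case: ifP => _; rewrite ?mul1e ?mul0e.
have WYk0 k w : 0 <= k%:E * (W \_ (Y @^-1` (f @^-1` [set k]))) w.
  have [k0|k0] := leP 0%R k.
    by apply: mule_ge0; [rewrite lee_fin|exact: erestrict_ge0].
  by rewrite preimage_nnfun0// preimage_set0 patch_set0 mule0.
have mWY k : measurable_fun setT (W \_ (Y @^-1` (f @^-1` [set k]))).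
  by apply/(measurable_restrictT W (mYf k)); exact: measurable_funTS.
rewrite ge0_integral_fsum//; last by move=> k; exact: measurable_funeM.
apply: eq_fsbigr => k /set_mem[t _ <-].
rewrite ge0_integralZl//; last by rewrite lee_fin.
  by rewrite -integral_mkcond.
by move=> w _; exact: erestrict_ge0.
Qed.

(** A substitute for conditioning on [Y]: the last hypothesis expresses E(W1 | Y) <= E(W2 | Y)
    without forming either side. Testing it on the level sets of simple functions and taking
    monotone limits gives every nonnegative [f]. In all uses [W2] is constant. *)
Lemma le_integral_mul_comp (W1 W2 : T -> \bar R) (Y : T -> T')
    (f : T' -> \bar R) :
  measurable_fun setT W1 -> measurable_fun setT W2 ->
  (forall w, 0 <= W1 w) -> (forall w, 0 <= W2 w) -> measurable_fun setT Y ->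
  measurable_fun setT f -> (forall y, 0 <= f y) ->
  (forall B, measurable B ->
    \int[mu]_(w in Y @^-1` B) W1 w <= \int[mu]_(w in Y @^-1` B) W2 w) ->
  \int[mu]_w (W1 w * f (Y w)) <= \int[mu]_w (W2 w * f (Y w)).
Proof.
move=> mW1 mW2 W10 W20 mY mf f0 leW.
pose f_ := nnsfun_approx measurableT mf.
have cvgW W : measurable_fun setT W -> (forall w, 0 <= W w) ->
    (fun n => \int[mu]_w (W w * (f_ n (Y w))%:E)) @ \oo -->
    \int[mu]_w (W w * f (Y w)).
  move=> mW W0.
  have := @cvg_monotone_convergence _ T R mu setT measurableT
    (fun n w => W w * (f_ n (Y w))%:E).
  rewrite (_ : \int[mu]_w limn _ = \int[mu]_w (W w * f (Y w))); first apply.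
  - move=> n; apply: emeasurable_funM => //; apply/measurable_EFinP.
    by apply: measurableT_comp => //.
  - by move=> n w _; apply: mule_ge0 => //; rewrite lee_fin.
  - move=> w _ m n mn; apply: lee_wpmul2l => //; rewrite lee_fin.
    exact/lefP/nd_nnsfun_approx.
  - apply: eq_integral => w _; apply/cvg_lim => //.
    have fY : (f_ n (Y w))%:E @[n --> \oo] --> f (Y w).
      exact: cvg_nnsfun_approx.
    have [Wfin|Winf] := boolP (W w \is a fin_num).
      exact: cvgeZl.
    have {Winf}-> : W w = +oo.
      by move: Winf (W0 w); rewrite fin_numE negb_and !negbK => /orP[]/eqP ->.
    (* With [W w] infinite the product is not continuous at 0: if [f (Y w)] vanishes then so do all
       the approximations, and otherwise they are eventually positive, so that the product is
       eventually +oo. *)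
    have [fY0|fY0] := eqVneq (f (Y w)) 0.
      rewrite fY0 mule0; apply: cvg_near_cst; apply: nearW => n.
      have : (f_ n (Y w))%:E <= f (Y w) by rewrite nnsfun_approxE; exact: le_approx.
      rewrite fY0 => fn0; have -> : (f_ n (Y w))%:E = 0.
        by apply/eqP; rewrite eq_le fn0/= lee_fin.
      by rewrite mule0.
    have fYp : 0 < f (Y w) by rewrite lt_neqAle eq_sym fY0 f0.
    rewrite gt0_mulye//; apply: cvg_near_cst.
    near=> n; rewrite gt0_mulye//.
    near: n; apply: (fY [set y | 0 < y]).
    exact: (open_ereal_gt' fYp).
apply: (cvge_to_le (cvgW _ mW1 W10)); apply: nearW => n.
apply: (@le_trans _ _ (\int[mu]_w (W2 w * (f_ n (Y w))%:E))).
  rewrite !integral_mul_nnsfun_comp// !fsbig_finite//=.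
  rewrite big_seq [leRHS]big_seq; apply: lee_sum => k.
  rewrite in_fset_set// inE => -[t _ <-].
  apply: lee_wpmul2l; first by rewrite lee_fin.
  by apply: leW; exact: measurable_funPTI.
apply: ge0_le_integral => //.
- by move=> w _; apply: mule_ge0 => //; rewrite lee_fin.
- apply: emeasurable_funM => //; apply/measurable_EFinP.
  exact: measurableT_comp.
- by apply: emeasurable_funM => //; exact: measurableT_comp.
- move=> w _; apply: lee_wpmul2l => //.
  by rewrite nnsfun_approxE; exact: le_approx.
Unshelve. all: by end_near. Qed.

End comparison.

Section independent_product.
Context {R : realType} {d d'} {T : measurableType d} {T' : measurableType d'}.
Variable P : probability T R.

(* By induction on the number of factors that are not indicators. *)
Lemma integral_prod_comp_le n (Y : 'I_n -> T -> T') (G : set T) (p : R)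
    (g : 'I_n -> T' -> R) (e : 'I_n -> R) :
  measurable G -> (forall i, measurable_fun setT (Y i)) -> 0 <= p ->
  (forall B : 'I_n -> set T', (forall i, measurable (B i)) ->
    fine (P (G `&` \bigcap_i (Y i @^-1` B i)))
      = p * \prod_i fine (P (Y i @^-1` B i))) ->
  (forall i, measurable_fun setT (g i)) -> (forall i y, 0 <= g i y) ->
  (forall i, \int[P]_w (g i (Y i w))%:E <= (e i)%:E)%E ->
  (\int[P]_w (\1_G w * \prod_i g i (Y i w))%:E <= (p * \prod_i e i)%:E)%E.
Proof.
move=> mG mY p0 hP.
have mYB i B : measurable B -> measurable (Y i @^-1` B).
  by move=> mB; rewrite -[X in measurable X]setTI; exact: mY.
have base (B : 'I_n -> set T') : (forall i, measurable (B i)) ->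
    forall e' : 'I_n -> R,
    (forall i, \int[P]_w (\1_(B i) (Y i w))%:E <= (e' i)%:E)%E ->
    (\int[P]_w (\1_G w * \prod_i (\1_(B i) (Y i w) : R))%:E
      <= (p * \prod_i e' i)%:E)%E.
  move=> mB e' he'.
  have mYBi : measurable (\bigcap_i (Y i @^-1` B i)).
    by apply: fin_bigcap_measurable => [|i _]; [exact: finite_finset|exact: mYB].
  have -> : (\int[P]_w (\1_G w * \prod_i (\1_(B i) (Y i w) : R))%:E
      = P (G `&` \bigcap_i (Y i @^-1` B i)))%E.
    rewrite -[X in P X]setIT -integral_indic//; last exact: measurableI.
    apply: eq_integral => w _; congr EFin.
    rewrite indicI/=; congr (_ * _).
    have [Yw|/existsNP[i /not_implyP[_ Yw]]] :=
        pselect ((\bigcap_i (Y i @^-1` B i)) w).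
      rewrite [RHS]indicE mem_set// big1// => i _.
      by rewrite indicE mem_set//; exact: Yw.
    rewrite [RHS]indicE memNset; last by move=> /(_ i I).
    by rewrite (bigD1 i)//= indicE memNset// mul0r.
  rewrite -[leLHS]fineK ?fin_num_measure//; last exact: measurableI.
  rewrite lee_fin hP//; apply: ler_wpM2l => //; apply: ler_prod => i _.
  rewrite fine_ge0//= -lee_fin fineK ?fin_num_measure//; last exact: mYB.
  apply: le_trans (he' i).
  by rewrite -[Y i @^-1` B i]setIT -integral_indic//; exact: mYB.
(* Factors of index at least [m] are indicators, the others are arbitrary. The hypothesis on events
   settles [m = 0], and [m = n] is the statement. *)
suff claim m : forall (h : 'I_n -> T' -> R) (e' : 'I_n -> R),
    (forall i : 'I_n, (m <= i)%N -> exists2 B, measurable B & h i = \1_B) ->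
    (forall i, measurable_fun setT (h i)) -> (forall i y, 0 <= h i y) ->
    (forall i, \int[P]_w (h i (Y i w))%:E <= (e' i)%:E)%E ->
    (\int[P]_w (\1_G w * \prod_i h i (Y i w))%:E <= (p * \prod_i e' i)%:E)%E.
  by apply: (claim n) => i; rewrite leqNgt ltn_ord.
elim: m => [|m IH] h e' hB mh h0 he'.
  have {hB}/choice[B hB] : forall i, exists B, measurable B /\ h i = \1_B.
    by move=> i; have [B] := hB i (leq0n i); exists B.
  have -> : h = fun i => \1_(B i) by apply/funext => i; exact: (hB i).2.
  apply: base => [i|i]; first exact: (hB i).1.
  by rewrite -(hB i).2.
have [mn|nm] := ltnP m n; last first.
  apply: IH => // i mi; have := ltn_ord i.
  by rewrite ltnNge (leq_trans nm mi).
pose j := Ordinal mn.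
have e'0 i : 0 <= e' i.
  rewrite -lee_fin; apply: le_trans (he' i).
  by apply: integral_ge0 => w _; rewrite lee_fin.
(* All factors except [j] are frozen into a weight, to be compared with the constant [c] on the
   events of [Y j]. *)
pose W1 w := \1_G w * \prod_(i | i != j) h i (Y i w).
pose c := p * \prod_(i | i != j) e' i.
have c0 : 0 <= c by apply: mulr_ge0 => //; apply: prodr_ge0.
have W10 w : 0 <= W1 w.
  by rewrite mulr_ge0 ?indicE//; apply: prodr_ge0 => i _.
have mW1 : measurable_fun setT W1.
  apply: measurable_funM => //.
  have -> : (fun w => \prod_(i | i != j) h i (Y i w)) =
      (fun w => \prod_i (if i != j then h i (Y i w) else 1)).
    by apply/funext => w; rewrite big_mkcond.
  apply: measurable_prod => i _; case: (i != j) => //.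
  exact: measurableT_comp.
have := @le_integral_mul_comp _ _ _ _ _ P (EFin \o W1) (cst c%:E) (Y j)
  (EFin \o h j).
have -> : (\int[P]_w ((EFin \o W1) w * (EFin \o h j) (Y j w)))%E =
   (\int[P]_w (\1_G w * \prod_i h i (Y i w))%:E)%E.
  apply: eq_integral => w _; rewrite -EFinM; congr EFin.
  by rewrite [in RHS](bigD1 j)//= /W1 mulrAC mulrA.
move=> H; apply: le_trans (H _ _ _ _ _ _ _ _) _ => //.
- exact/measurable_EFinP.
- exact/measurable_EFinP.
- by move=> y; rewrite /= lee_fin.
- move=> B mB.
  rewrite integral_cst//; last exact: mYB.
  (* Restricting to the event that [Y j] lies in [B] turns factor [j] into an indicator, whose bound
     is its exact probability. One general factor fewer: the induction hypothesis is the comparison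
     on that event. *)
  pose h' i := if i == j then \1_B else h i : T' -> R.
  pose e'' i := if i == j then fine (P (Y j @^-1` B)) else e' i.
  have := IH h' e''.
  have -> : (\int[P]_w (\1_G w * \prod_i h' i (Y i w))%:E =
      \int[P]_(w in Y j @^-1` B) (EFin \o W1) w)%E.
    rewrite [RHS]integral_mkcond; apply: eq_integral => w _.
    rewrite patchE (bigD1 j)//= /h' eqxx.
    have -> : \prod_(i < n | i != j) (if i == j then \1_B else h i) (Y i w)
        = \prod_(i < n | i != j) h i (Y i w).
      by apply: eq_bigr => i /negbTE ->.
    have -> : \1_B (Y j w) = (Y j w \in B)%:R :> R by rewrite indicE.
    rewrite (_ : (w \in Y j @^-1` B) = (Y j w \in B)); last first.
      by apply/idP/idP; rewrite !inE.
    by case: (Y j w \in _); rewrite /= ?(mul1r, mul0r, mulr0).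
  have -> : (p * \prod_i e'' i)%:E = (c%:E * P (Y j @^-1` B))%E.
    rewrite (bigD1 j)//= /e'' eqxx mulrCA mulrC EFinM fineK ?fin_num_measure//.
      congr (_%:E * _)%E; congr (_ * _).
      by apply: eq_bigr => i /negbTE ->.
    exact: mYB.
  apply.
  + move=> i mi; rewrite /h'; case: eqP => [_|/eqP ij]; first by exists B.
    by apply: hB; rewrite ltn_neqAle mi andbT; apply: contra ij => /eqP mi';
      apply/eqP/val_inj.
  + by move=> i; rewrite /h'; case: ifP => // _; exact: measurable_indic.
  + by move=> i y; rewrite /h'; case: ifP => // _; rewrite indicE.
  + move=> i; rewrite /h' /e''; case: eqP => [->|_]; last exact: he'.
    rewrite fineK ?fin_num_measure//; last exact: mYB.
    by rewrite -[X in P X]setIT -integral_indic//; exact: mYB.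
- rewrite ge0_integralZl//=.
  + rewrite (bigD1 j)//= mulrCA [leRHS]EFinM muleC.
    by apply: lee_wpmul2r; [rewrite lee_fin|exact: he'].
  + by apply/measurable_EFinP; exact: measurableT_comp.
  + by move=> w _; rewrite /= lee_fin.
Qed.

End independent_product.

(** * Exponential moments *)

Section exp_bounds.
Context {R : realType}.
Implicit Types x : R.

(** Since exp(-x) >= 1 - x, it suffices that (1 + x + 2x^2)(1 - x) = 1 + x^2(1 - 2x) be at least
    1. *)
Lemma expR_le_1D2sqr x : x <= 2^-1 -> expR x <= 1 + x + 2 * x ^+ 2.
Proof.
move=> x2; have e0 := expR_gt0 (- x).
rewrite (_ : expR x = (expR (- x))^-1); last by rewrite -expRN opprK.
rewrite -(ler_pM2r e0) mulVf ?gt_eqF//.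
have := expR_ge1Dx (- x); move: (expR (- x)) e0 => e e0 he.
have : 0 <= 1 + x + 2 * x ^+ 2 by nra.
nra.
Qed.

(** For x >= 0, multiply by exp(-x) >= 1 - x. For x < 0, exp|x| >= 1 and (1 + x + x^2)(1 - x) = 1 -
    x^3 >= 1. The remainder keeps a full exponential, to be integrated term by term against moments
    of all orders. *)
Lemma expR_le_1Dsqr_expR x : expR x <= 1 + x + x ^+ 2 * expR `|x|.
Proof.
have e0 := expR_gt0 (- x).
have [x0|x0] := leP 0 x.
  rewrite ger0_norm// (_ : expR x = (expR (- x))^-1); last by rewrite -expRN opprK.
  rewrite -(ler_pM2r e0) mulrDl -mulrA mulVf ?gt_eqF// mulr1.
  by have := expR_ge1Dx (- x); move: (expR (- x)) e0 => e e0 he; nra.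
have : 1 <= expR `|x| by rewrite -expR0 ler_expR.
rewrite ltr0_norm// => e1.
rewrite (_ : expR x = (expR (- x))^-1); last by rewrite -expRN opprK.
rewrite -(ler_pM2r e0) mulVf ?gt_eqF//.
have := expR_ge1Dx (- x); move: (expR (- x)) e0 e1 => e e0 e1 he.
have : 1 <= (1 + x + x ^+ 2) * (1 - x) by nra.
have : 0 <= x ^+ 2 * (e - 1) by nra.
have : 0 <= 1 + x + x ^+ 2 by nra.
nra.
Qed.

End exp_bounds.

Section bernstein.
Context {R : realType} {d} {T : measurableType d}.
Variable P : probability T R.
Variables (f : T -> R) (v c u : R).
Hypothesis mf : measurable_fun setT f.
Hypothesis c0 : 0 <= c.
Hypothesis v0 : 0 <= v.
Hypothesis f1 : (\int[P]_w (f w)%:E = 0)%E.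
Hypothesis f2 : (\int[P]_w (f w ^+ 2)%:E <= v%:E)%E.
Hypothesis fq : forall q : nat, (3 <= q)%N ->
  (\int[P]_w (`|f w| ^+ q)%:E <= (v * c ^+ (q - 2) * q`!%:R / 2)%:E)%E.
Hypothesis uc : `|u| * c <= 6^-1.

Let moment q :
  (\int[P]_w (`|f w| ^+ q.+2)%:E <= (v * c ^+ q * q.+2`!%:R / 2)%:E)%E.
Proof.
case: q => [|q].
  rewrite expr0 mulr1 -mulrA divff// mulr1; apply: le_trans f2.
  by under eq_integral do rewrite real_normK ?num_real//.
by have := @fq q.+3 isT; rewrite (_ : (q.+3 - 2)%N = q.+1)// !subSS subn0.
Qed.

Let term q w := (u * f w) ^+ 2 * exp_coeff `|u * f w| q.

Let mterm q : measurable_fun setT (term q).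
Proof.
rewrite /term /exp_coeff/=; apply: measurable_funM.
  by apply: measurable_funX; exact: measurable_funM.
apply: measurable_funM => //; apply: measurable_funX.
by apply: measurableT_comp => //; exact: measurable_funM.
Qed.

Let term0 q w : 0 <= term q w.
Proof. by rewrite mulr_ge0 ?sqr_ge0// divr_ge0// exprn_ge0. Qed.

Let termE w :
  (\sum_(0 <= q <oo) (term q w)%:E = ((u * f w) ^+ 2 * expR `|u * f w|)%:E)%E.
Proof.
apply/cvg_lim => //.
rewrite (_ : (fun n => _) = EFin \o
    (fun n => (u * f w) ^+ 2 * series (exp_coeff `|u * f w|) n)).
  apply: cvg_EFin; first exact: nearW.
  by apply: cvgM; [exact: cvg_cst|exact: is_cvg_series_exp_coeff].
by apply/funext => n /=; rewrite sumEFin /series/= mulr_sumr.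
Qed.

Let term_le q : (\int[P]_w (term q w)%:E <= (u ^+ 2 * v * 2^-1 ^+ q)%:E)%E.
Proof.
have -> : (\int[P]_w (term q w)%:E =
    (`|u| ^+ q.+2 / q`!%:R)%:E * \int[P]_w (`|f w| ^+ q.+2)%:E)%E.
  rewrite -ge0_integralZl//=.
  - apply: eq_integral => w _; rewrite -EFinM; congr EFin.
    rewrite /term /exp_coeff/= -(real_normK (num_real (u * f w))) normrM.
    by rewrite !exprMn !exprS; ring.
  - by apply/measurable_EFinP; apply: measurable_funX; exact: measurableT_comp.
apply: le_trans (lee_wpmul2l _ (moment q)) _.
  by rewrite lee_fin divr_ge0// exprn_ge0.
rewrite -EFinM lee_fin.
have -> : `|u| ^+ q.+2 / q`!%:R * (v * c ^+ q * q.+2`!%:R / 2)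
    = u ^+ 2 * v * ((`|u| * c) ^+ q * ((q.+2 * q.+1)%:R / 2)).
  rewrite 2!factS mulnA natrM -(real_normK (num_real u)) exprMn expr2.
  rewrite (exprS _ q.+1) (exprS _ q); move: (`|u| ^+ q) (c ^+ q) => a b.
  by field; rewrite pnatr_eq0 -lt0n fact_gt0.
apply: ler_wpM2l; first by rewrite mulr_ge0 ?sqr_ge0.
(* (q+1)(q+2)/2 <= 3^q, so that |u| c <= 1/6 leaves a geometric series of ratio 1/2 and sum 2. *)
apply: (@le_trans _ _ (6^-1 ^+ q * 3 ^+ q)).
  apply: ler_pM; rewrite ?exprn_ge0 ?mulr_ge0//.
    by rewrite lerXn2r ?nnegrE ?mulr_ge0.
  elim: q => [|q IH]; first by rewrite expr0 divff.
  rewrite exprS; apply: le_trans (ler_wpM2l (ler0n _ 3) IH).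
  by rewrite !natrM -[q.+3]addn3 -[q.+2]addn2 -[q.+1]addn1 !natrD; have := ler0n R q; nra.
by rewrite -exprMn (_ : 6^-1 * 3 = 2^-1 :> R)//; lra.
Qed.

Let remainder_le :
  (\int[P]_w ((u * f w) ^+ 2 * expR `|u * f w|)%:E <= (2 * u ^+ 2 * v)%:E)%E.
Proof.
under eq_integral do rewrite -termE.
rewrite integral_nneseries//; last 2 first.
- by move=> q; apply/measurable_EFinP; exact: mterm.
- by move=> q w _; rewrite lee_fin.
apply: lime_le.
  by apply: is_cvg_nneseries => q _ _; apply: integral_ge0 => w _; rewrite lee_fin.
apply: nearW => n.
apply: le_trans (lee_sum _ (fun q _ => term_le q)) _.
rewrite sumEFin lee_fin -mulr_sumr -[2 * u ^+ 2 * v]mulrA mulrC.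
apply: ler_wpM2r; first by rewrite mulr_ge0 ?sqr_ge0.
have -> : \sum_(0 <= i < n) 2^-1 ^+ i = 2 - 2 * 2^-1 ^+ n :> R.
  elim: n => [|n IH]; first by rewrite big_geq// expr0 mulr1 subrr.
  by rewrite big_nat_recr//= IH exprS; field.
by rewrite gerBl mulr_ge0// exprn_ge0.
Qed.

Let intf : P.-integrable setT (EFin \o f).
Proof.
have mfE : measurable_fun setT (EFin \o f) by exact/measurable_EFinP.
apply/integrableP; split => //.
apply: (@le_lt_trans _ _ (\int[P]_w (1 + (f w) ^+ 2)%:E)%E).
  apply: ge0_le_integral => //=.
  - by apply/measurable_EFinP; exact: measurableT_comp.
  - apply/measurable_EFinP; apply: measurable_funD => //.
    exact: measurable_funX.
  - move=> w _; rewrite lee_fin; have [f0|f0] := ler0P (f w);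
      have := sqr_ge0 (f w - 1); have := sqr_ge0 (f w + 1); nra.
under eq_integral do rewrite EFinD.
rewrite ge0_integralD//=.
- rewrite integral_cst//= probability_setT mule1.
  by apply: lte_add_pinfty; [exact: ltry|exact: le_lt_trans f2 (ltry _)].
- by move=> w _; rewrite lee_fin sqr_ge0.
- by apply/measurable_EFinP; exact: measurable_funX.
Qed.

(** The first-order term vanishes because [f] is centred. The remainder (uf)^2 exp|uf| is expanded
    in powers of |uf|: its q-th term has mean at most u^2 v 2^(-q). *)
Lemma mgf_le : (\int[P]_w (expR (u * f w))%:E <= (1 + 2 * u ^+ 2 * v)%:E)%E.
Proof.
pose g w := (u * f w) ^+ 2 * expR `|u * f w|.
have g0 w : 0 <= g w by rewrite mulr_ge0 ?sqr_ge0 ?expR_ge0.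
have muf : measurable_fun setT (fun w => u * f w) by exact: measurable_funM.
have mg : measurable_fun setT g.
  apply: measurable_funM; first exact: measurable_funX.
  by apply: measurableT_comp => //; exact: measurableT_comp.
have intg : P.-integrable setT (EFin \o g).
  apply/integrableP; split; first exact/measurable_EFinP.
  rewrite (eq_integral (EFin \o g)); last by move=> w _ /=; rewrite ger0_norm.
  exact: le_lt_trans remainder_le (ltry _).
have intuf : P.-integrable setT (fun w => (u * f w)%:E).
  by under eq_fun do rewrite EFinM; exact: integrableZl.
have int1 : P.-integrable setT (fun w => 1%:E : \bar R).
  exact: finite_measure_integrable_cst.
apply: (@le_trans _ _ (\int[P]_w ((1 + u * f w) + g w)%:E)%E).
  apply: ge0_le_integral => //=.
  - by apply/measurable_EFinP; exact: measurableT_comp.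
  - apply/measurable_EFinP; apply: measurable_funD => //.
    exact: measurable_funD.
  - by move=> w _; rewrite lee_fin; exact: expR_le_1Dsqr_expR.
under eq_integral do rewrite EFinD.
rewrite integralD//=; last first.
  by under eq_fun do rewrite EFinD; exact: integrableD.
under eq_integral do rewrite EFinD.
rewrite integralD//= integral_cst//= probability_setT mule1.
under eq_integral do rewrite EFinM.
rewrite integralZl// f1 mule0 adde0 EFinD; apply: leeD => //.
Qed.

End bernstein.

(** * Phi-mixing *)

Section count_steps.
Context {R : realType}.

(** The sum is the minimum of [N] and the integer part of [y]. Together with [sum_steps_ge] this
    encloses [y] between two step functions at distance 1. *)
Lemma sum_steps_le N (y : R) : 0 <= y ->
  \sum_(k < N) (k.+1%:R <= y)%R%:R <= y.
Proof.
move=> y0; elim: N => [|N IH]; first by rewrite big_ord0.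
rewrite big_ord_recr/=; have [Ny|_] := lerP N.+1%:R y; last by rewrite mulr0n addr0.
apply: le_trans Ny; rewrite -natr1 lerD//.
apply: (@le_trans _ _ (\sum_(k < N) 1)); last by rewrite sumr_const card_ord.
by apply: ler_sum => k _; rewrite lern1 leq_b1.
Qed.

Lemma sum_steps_ge N (y : R) : y <= N%:R ->
  y <= 1 + \sum_(k < N) (k.+1%:R <= y)%R%:R.
Proof.
have all_steps K : K%:R <= y -> \sum_(k < K) (k.+1%:R <= y)%R%:R = K%:R :> R.
  move=> Ky; transitivity (\sum_(k < K) (1 : R)); last by rewrite sumr_const card_ord.
  apply: eq_bigr => k _.
  by rewrite (le_trans _ Ky)// ler_nat.
elim: N => [y0|N IH yN]; first by rewrite big_ord0 addr0 (le_trans y0).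
have [/all_steps ->|yN1] := leP N.+1%:R y; first by rewrite (le_trans yN)// lerDr.
have [/IH /le_trans|Ny] := leP y N%:R; last first.
  by rewrite big_ord_recr/= (all_steps _ (ltW Ny)) [1 + _]addrC -addrA;
    rewrite (le_trans (ltW yN1))// -natr1 lerD2l lerDr.
by apply; rewrite lerD2l big_ord_recr/= lerDl.
Qed.

End count_steps.

Section event_covariance.
Context {R : realType} {d} {T : measurableType d}.
Variable P : probability T R.

Let integral_steps (A : set T) N (B : 'I_N -> set T) (c b : R) :
  measurable A -> (forall k, measurable (B k)) -> 0 <= c -> 0 <= b ->
  (\int[P]_(w in A) (c * (b + \sum_(k < N) \1_(B k) w))%:E =
   (c * (b * fine (P A) + \sum_(k < N) fine (P (A `&` B k))))%:E)%E.
Proof.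
move=> mA mB c0 b0.
under eq_integral do rewrite EFinM EFinD.
have mS : measurable_fun A (fun w => (\sum_(k < N) \1_(B k) w : R)%:E).
  apply/measurable_EFinP; apply: measurable_sum => k.
  exact: measurable_indic.
rewrite ge0_integralZl//=; last 2 first.
- by apply: emeasurable_funD.
- by move=> w _; rewrite adde_ge0 ?lee_fin// sumr_ge0.
rewrite ge0_integralD//=; last first.
- by move=> w _; rewrite lee_fin sumr_ge0.
under [X in (_ * (_ + X))%E]eq_integral do rewrite -sumEFin.
rewrite ge0_integral_sum//; last first.
  by move=> k; apply/measurable_EFinP; exact: measurable_indic.
rewrite integral_cst// EFinM EFinD EFinM fineK ?fin_num_measure//.
congr (_ * (_ + _))%E; rewrite -sumEFin; apply: eq_bigr => k _.
rewrite integral_indic// setIC fineK// fin_num_measure//.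
exact: measurableI.
Qed.

(* Layer cake: V lies between two step functions that count the levels it
   exceeds, and the hypothesis applies to each level set. *)
Lemma integral_event_le (A : set T) (V : T -> R) (M phi : R) :
  measurable A -> measurable_fun setT V -> (forall w, 0 <= V w <= M) ->
  0 < M -> 0 <= phi ->
  (forall r, fine (P (A `&` [set w | r <= V w])) <=
     fine (P A) * fine (P [set w | r <= V w]) + phi * fine (P A)) ->
  (\int[P]_(w in A) (V w)%:E <= P A * (\int[P]_w (V w)%:E + (M * phi)%:E))%E.
Proof.
move=> mA mV V0M M0 phi0 hphi.
have mB r : measurable [set w | r <= V w].
  rewrite -[X in measurable X]setTI.
  have -> : [set w | r <= V w] = V @^-1` `[r, +oo[%classic.
    by apply/seteqP; split => w /=; rewrite in_itv/= andbT.
  exact: mV.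
have V0 w : 0 <= V w by have /andP[] := V0M w.
have VM w : V w <= M by have /andP[] := V0M w.
have mVE : measurable_fun setT (fun w => (V w)%:E) by exact/measurable_EFinP.
have VT : (\int[P]_w (V w)%:E)%E \is a fin_num.
  rewrite ge0_fin_numE; last by apply: integral_ge0 => w _; rewrite lee_fin.
  apply: (@le_lt_trans _ _ (\int[P]_w (M%:E))%E); last first.
    by rewrite integral_cst//= probability_setT mule1 ltry.
  by apply: ge0_le_integral => //= w _; rewrite lee_fin.
rewrite -(fineK VT) -[P A]fineK ?fin_num_measure// -EFinD -EFinM.
set p := fine (P A); set I := fine _.
have p0 : 0 <= p by exact: fine_ge0.
apply/lee_addgt0Pr => e e0; rewrite -EFinD.
(* The step functions below and above [V] differ by M/N, hence their integrals over [A] by p M/N,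
   which this choice of [N] makes at most [e]. *)
have [N N0 hN] : exists2 N, (0 < N)%N & p * (M / N%:R) <= e.
  exists (Num.truncn (p * M / e)).+1 => //.
  rewrite mulrA ler_pdivrMr ?ltr0n// [e * _]mulrC -ler_pdivrMr//.
  by rewrite ltW// truncnS_gt.
have N0' : 0 < N%:R :> R by rewrite ltr0n.
pose B (k : 'I_N) := [set w | k.+1%:R * (M / N%:R) <= V w].
have stepE w : \sum_(k < N) \1_(B k) w
    = \sum_(k < N) (k.+1%:R <= V w * (N%:R / M))%R%:R :> R.
  apply: eq_bigr => k _; rewrite indicE; congr (nat_of_bool _)%:R; apply/idP/idP.
    by rewrite inE /B/= => h; rewrite -ler_pdivrMr ?divr_gt0// invf_div.
  by move=> h; rewrite inE /B/= -invf_div ler_pdivrMr ?divr_gt0.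
have c0 : 0 <= M / N%:R by rewrite divr_ge0// ltW.
have lower w : M / N%:R * (0 + \sum_(k < N) \1_(B k) w) <= V w.
  rewrite add0r stepE -ler_pdivlMl ?divr_gt0// invf_div mulrC.
  by apply: sum_steps_le; rewrite mulr_ge0 ?V0// divr_ge0// ltW.
have upper w : V w <= M / N%:R * (1 + \sum_(k < N) \1_(B k) w).
  rewrite stepE -ler_pdivrMl ?divr_gt0// invf_div mulrC.
  apply: sum_steps_ge; rewrite mulrA ler_pdivrMr// mulrC.
  by rewrite ler_pM2l.
have mBk k : measurable (B k) by exact: mB.
have mSt b : measurable_fun setT (fun w => M / N%:R * (b + \sum_(k < N) \1_(B k) w)).
  apply: measurable_funM => //; apply: measurable_funD => //.
  by apply: measurable_sum => k; exact: measurable_indic.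
have low : M / N%:R * (\sum_(k < N) fine (P (B k))) <= I.
  rewrite -lee_fin /I fineK//.
  apply: (@le_trans _ _
    (\int[P]_w (M / N%:R * (0 + \sum_(k < N) \1_(B k) w))%:E)%E).
    rewrite integral_steps// mul0r add0r.
    by under [X in (_ <= (_ * X)%:E)%E]eq_bigr do rewrite setTI.
  apply: ge0_le_integral => //=.
  - by move=> w _; rewrite lee_fin mulr_ge0// add0r sumr_ge0.
  - exact/measurable_EFinP.
  - by move=> w _; rewrite lee_fin.
apply: (@le_trans _ _
    (\int[P]_(w in A) (M / N%:R * (1 + \sum_(k < N) \1_(B k) w))%:E)%E).
  apply: ge0_le_integral => //=.
  - by move=> w _; rewrite lee_fin.
  - exact: measurable_funTS.
  - by apply/measurable_EFinP; exact: measurable_funTS.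
  - by move=> w _; rewrite lee_fin.
rewrite integral_steps// lee_fin mul1r -/p.
(* The correction [phi * p] is paid at each of [N] levels of height M/N, in total p M phi. *)
apply: (@le_trans _ _ (M / N%:R *
    (p + \sum_(k < N) (p * fine (P (B k)) + phi * p)))).
  by apply: ler_wpM2l => //; rewrite lerD2l; apply: ler_sum => k _; exact: hphi.
rewrite big_split/= -mulr_sumr sumr_const card_ord -[phi * p *+ N]mulr_natl.
have -> : M / N%:R * (p + (p * (\sum_(k < N) fine (P (B k))) + N%:R * (phi * p)))
  = p * (M / N%:R) + p * (M / N%:R * \sum_(k < N) fine (P (B k))) + p * (M * phi).
  by field; rewrite gt_eqF.
have := ler_wpM2l p0 low; move: hN; set x := p * (M / _); set y := p * (_ * _).
by move=> ? ?; rewrite mulrDr; lra.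
Qed.

End event_covariance.

Section bounded_expectation.
Context {R : realType} {d} {T : measurableType d}.
Variable P : probability T R.

Definition bounded_mfun (f : T -> R) :=
  measurable_fun setT f /\ exists M, forall w, `|f w| <= M.

Lemma bounded_mfun_integrable f : bounded_mfun f -> P.-integrable setT (EFin \o f).
Proof.
move=> [mf [M hM]]; apply: measurable_bounded_integrable => //.
  by rewrite /= probability_setT ltry.
by exists M; split; [exact: num_real|move=> x Mx w _; exact: le_trans (hM w) (ltW Mx)].
Qed.

Lemma bounded_mfun_fineK f : bounded_mfun f ->
  (\int[P]_w (f w)%:E)%E = (\int[P]_w f w)%:E.
Proof.
by move=> /bounded_mfun_integrable h; rewrite /Rintegral fineK//; exact: integrable_fin_num.
Qed.

Lemma bounded_mfun_cst r : bounded_mfun (cst r).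
Proof. by split => //; exists `|r|. Qed.

Lemma bounded_mfunD f g : bounded_mfun f -> bounded_mfun g ->
  bounded_mfun (fun w => f w + g w).
Proof.
move=> [mf [M hM]] [mg [N hN]]; split; first exact: measurable_funD.
by exists (M + N) => w; rewrite (le_trans (ler_normD _ _))// lerD.
Qed.

Lemma bounded_mfunM f g : bounded_mfun f -> bounded_mfun g ->
  bounded_mfun (fun w => f w * g w).
Proof.
move=> [mf [M hM]] [mg [N hN]]; split; first exact: measurable_funM.
by exists (M * N) => w; rewrite normrM ler_pM.
Qed.

Lemma bounded_mfunZl r f : bounded_mfun f -> bounded_mfun (fun w => r * f w).
Proof. by move=> bf; exact: bounded_mfunM (bounded_mfun_cst r) bf. Qed.

Lemma bounded_mfunN f : bounded_mfun f -> bounded_mfun (fun w => - f w).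
Proof.
move=> [mf [M hM]]; split; first exact: measurableT_comp.
by exists M => w; rewrite normrN.
Qed.

Lemma bounded_mfun_expR f : bounded_mfun f -> bounded_mfun (fun w => expR (f w)).
Proof.
move=> [mf [M hM]]; split; first exact: measurableT_comp.
by exists (expR M) => w; rewrite ger0_norm ?expR_ge0// ler_expR (le_trans (ler_norm _)).
Qed.

Lemma bounded_mfun_norm f : bounded_mfun f -> bounded_mfun (fun w => `|f w|).
Proof.
move=> [mf [M hM]]; split; first exact: measurableT_comp.
by exists M => w; rewrite normr_id.
Qed.

Lemma bounded_mfun_sum n (f : 'I_n -> T -> R) : (forall i, bounded_mfun (f i)) ->
  bounded_mfun (fun w => \sum_i f i w).
Proof.
move=> hf; split; first by apply: measurable_sum => i; exact: (hf i).1.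
have /choice[M hM] := fun i => (hf i).2.
by exists (\sum_i M i) => w; apply: le_trans (ler_norm_sum _ _ _) (ler_sum _ _) => i _.
Qed.

Lemma bounded_RintegralD f g : bounded_mfun f -> bounded_mfun g ->
  \int[P]_w (f w + g w) = \int[P]_w f w + \int[P]_w g w.
Proof. by move=> /bounded_mfun_integrable ? /bounded_mfun_integrable ?; exact: RintegralD. Qed.

Lemma bounded_RintegralZl f r : bounded_mfun f ->
  \int[P]_w (r * f w) = r * \int[P]_w f w.
Proof. by move=> /bounded_mfun_integrable ?; exact: RintegralZl. Qed.

Lemma bounded_Rintegral_cst r : \int[P]_w r = r.
Proof. by rewrite Rintegral_cst//= probability_setT mulr1. Qed.

Lemma bounded_le_Rintegral f g : bounded_mfun f -> bounded_mfun g ->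
  (forall w, f w <= g w) -> \int[P]_w f w <= \int[P]_w g w.
Proof.
by move=> /bounded_mfun_integrable ? /bounded_mfun_integrable ? ?; exact: le_Rintegral.
Qed.

Lemma bounded_Rintegral_sum n (f : 'I_n -> T -> R) : (forall i, bounded_mfun (f i)) ->
  \int[P]_w (\sum_i f i w) = \sum_i \int[P]_w f i w.
Proof.
elim: n f => [|n IH] f hf.
  by rewrite big_ord0; under eq_Rintegral do rewrite big_ord0; exact: bounded_Rintegral_cst.
under eq_Rintegral do rewrite big_ord_recl.
rewrite bounded_RintegralD//; last exact: bounded_mfun_sum.
by rewrite big_ord_recl IH.
Qed.

End bounded_expectation.

Section mixing_covariance.
Context {R : realType} {d} {T : measurableType d}.
Variable P : probability T R.
Variables (G H : set (set T)) (phi : R).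
Hypothesis mG : <<s G >> `<=` measurable.
Hypothesis mH : <<s H >> `<=` measurable.
Hypothesis phi0 : 0 <= phi.
Hypothesis mix : forall A B, <<s G >> A -> <<s H >> B ->
  fine (P (A `&` B)) <= fine (P A) * fine (P B) + phi * fine (P A).

(** [V + M] takes values in [0, 2M], so [integral_event_le] bounds its integral over an event
    generated by [G] by M + 2 M phi times the probability of that event. Passing from events to [U]
    and cancelling the integral of [M * U] leaves the claim. *)
Lemma mixing_Rintegral_le (U V : T -> R) (M C : R) :
  measurable_fun setT (U : g_sigma_algebraType G -> R) ->
  measurable_fun setT (V : g_sigma_algebraType H -> R) ->
  (forall w, 0 <= U w <= C) -> 0 < M -> (forall w, `|V w| <= M) ->
  \int[P]_w V w = 0 ->
  \int[P]_w (U w * V w) <= 2 * M * phi * \int[P]_w U w.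
Proof.
move=> mU mV U0C M0 VM EV.
have sub (F : set (set T)) (f : T -> R) : <<s F >> `<=` measurable ->
    measurable_fun setT (f : g_sigma_algebraType F -> R) -> measurable_fun setT f.
  by move=> mF mf _ B mB; apply: mF; exact: mf.
have bU : bounded_mfun U.
  split; first exact: sub mG mU.
  by exists C => w; have /andP[? ?] := U0C w; rewrite ger0_norm.
have bV : bounded_mfun V by split; [exact: sub mH mV|exists M].
have bVM : bounded_mfun (fun w => V w + M).
  exact: bounded_mfunD bV (bounded_mfun_cst M).
have VM0 w : 0 <= V w + M <= 2 * M.
  by have := VM w; rewrite ler_norml => /andP[? ?]; apply/andP; split; lra.
have M2 : 0 <= M + 2 * M * phi.
  by apply: addr_ge0; [exact: ltW|rewrite !mulr_ge0// ltW].
(* The map given to the comparison is the identity, onto the same set with the coarser sigma-algebra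
   generated by [G]. *)
have H1 := @le_integral_mul_comp R d _ T (g_sigma_algebraType G) P
  (fun w => (V w + M)%:E) (cst (M + 2 * M * phi)%:E) (fun w => w)
  (fun w => (U w)%:E).
have : (\int[P]_w ((V w + M) * U w)%:E <=
    \int[P]_w ((M + 2 * M * phi) * U w)%:E)%E.
  apply: H1.
  - by apply/measurable_EFinP; exact: bVM.1.
  - exact: measurable_cst.
  - by move=> w; rewrite lee_fin; have /andP[] := VM0 w.
  - by move=> w; rewrite lee_fin.
  - by move=> _ B mB; rewrite setTI; exact: mG.
  - exact/measurable_EFinP.
  - by move=> w; rewrite lee_fin; have /andP[] := U0C w.
  - move=> B mB; rewrite /= preimage_id.
    rewrite integral_cst; last exact: mG.
    rewrite muleC (_ : M + _ = \int[P]_w (V w + M) + 2 * M * phi); last first.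
      by rewrite bounded_RintegralD// ?EV ?add0r ?bounded_Rintegral_cst//;
        exact: bounded_mfun_cst.
    rewrite EFinD -bounded_mfun_fineK//.
    apply: integral_event_le => //; [exact: mG|exact: bVM.1|by rewrite mulr_gt0|].
    move=> r; apply: mix => //.
    have -> : [set w | r <= V w + M] = V @^-1` `[r - M, +oo[%classic.
      by apply/seteqP; split => w /=; rewrite in_itv/= andbT lerBlDr.
    by rewrite -[X in <<s _ >> X]setTI; apply: mV.
have bVMU : bounded_mfun (fun w => (V w + M) * U w) by exact: bounded_mfunM.
have bMU : bounded_mfun (fun w => (M + 2 * M * phi) * U w).
  exact: bounded_mfunZl.
rewrite !bounded_mfun_fineK// lee_fin bounded_RintegralZl//.
have -> : (fun w => (V w + M) * U w) = (fun w => U w * V w + M * U w).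
  by apply/funext => w; ring.
rewrite bounded_RintegralD ?bounded_RintegralZl//; last 2 first.
- exact: bounded_mfunM.
- exact: bounded_mfunZl.
by move=> h; lra.
Qed.

(** Split [X] into its positive and negative parts and pair the latter with [- V], again centred and
    bounded by [M]. The bound involves the L^1 norm of [X], not its supremum [C], which lets
    increments of an exponential be measured by the mean of that exponential. *)
Lemma mixing_covariance_le (X V : T -> R) (M C : R) :
  measurable_fun setT (X : g_sigma_algebraType G -> R) ->
  measurable_fun setT (V : g_sigma_algebraType H -> R) ->
  (forall w, `|X w| <= C) -> 0 < M -> (forall w, `|V w| <= M) ->
  \int[P]_w V w = 0 ->
  `|\int[P]_w (X w * V w)| <= 2 * M * phi * \int[P]_w `|X w|.
Proof.
move=> mX mV XC M0 VM EV.
have bV : bounded_mfun V.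
  by split; [move=> _ B mB; apply: mH; exact: mV|exists M].
have bX : bounded_mfun X.
  by split; [move=> _ B mB; apply: mG; exact: mX|exists C].
have EVN : \int[P]_w - V w = 0.
  under eq_Rintegral do rewrite -mulN1r.
  by rewrite bounded_RintegralZl// EV mulr0.
have part (Y W : T -> R) : measurable_fun setT (Y : g_sigma_algebraType G -> R) ->
    measurable_fun setT (W : g_sigma_algebraType H -> R) ->
    (forall w, `|Y w| <= C) -> (forall w, `|W w| <= M) -> \int[P]_w W w = 0 ->
    \int[P]_w (Num.max 0 (Y w) * W w) <= 2 * M * phi * \int[P]_w Num.max 0 (Y w).
  move=> mY mW YC WM EW.
  apply: (@mixing_Rintegral_le (fun w => Num.max 0 (Y w)) W M C) => //.
    exact: measurable_maxr.
  move=> w; rewrite le_max lexx/= ge_max (le_trans _ (YC w))//=.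
  exact: le_trans (ler_norm _) (YC w).
have b_max Y : bounded_mfun Y -> bounded_mfun (fun w => Num.max 0 (Y w)).
  move=> [mY [B hB]]; split; first exact: measurable_maxr.
  exists B => w; rewrite ger0_norm ?le_max ?lexx// ge_max.
  by rewrite (le_trans _ (hB w))//= (le_trans (ler_norm _) (hB w)).
have mXN : measurable_fun setT ((fun w => - X w) : g_sigma_algebraType G -> R).
  exact: measurableT_comp.
have mVN : measurable_fun setT ((fun w => - V w) : g_sigma_algebraType H -> R).
  exact: measurableT_comp.
have XNC w : `|- X w| <= C by rewrite normrN.
have VNM w : `|- V w| <= M by rewrite normrN.
have bXN := bounded_mfunN bX; have bVN := bounded_mfunN bV.
have EX : \int[P]_w `|X w| =
    \int[P]_w Num.max 0 (X w) + \int[P]_w Num.max 0 (- X w).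
  rewrite -bounded_RintegralD; [|exact: b_max|exact: b_max].
  apply: eq_Rintegral => w _; have /orP[X0|X0] := le_total 0 (X w).
    by rewrite ger0_norm// max_r// max_l ?oppr_le0// addr0.
  by rewrite ler0_norm// (max_l X0) add0r max_r// oppr_ge0.
have EXW W : bounded_mfun W -> \int[P]_w (X w * W w) =
    \int[P]_w (Num.max 0 (X w) * W w) + \int[P]_w (Num.max 0 (- X w) * - W w).
  move=> bW; rewrite -bounded_RintegralD; last 2 first.
  - by apply: bounded_mfunM => //; exact: b_max.
  - by apply: bounded_mfunM; [exact: b_max|exact: bounded_mfunN].
  apply: eq_Rintegral => w _; have /orP[X0|X0] := le_total 0 (X w).
    by rewrite max_r// max_l ?oppr_le0// mul0r addr0.
  by rewrite (max_l X0) mul0r add0r max_r ?mulrNN// oppr_ge0.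
rewrite ler_norml; apply/andP; split; last first.
  by rewrite EXW// EX mulrDr lerD// part.
rewrite lerNl.
have -> : - (\int[P]_w (X w * V w)) = \int[P]_w (X w * - V w).
  rewrite -mulN1r -bounded_RintegralZl; last exact: bounded_mfunM.
  by apply: eq_Rintegral => w _; ring.
rewrite EXW// EX mulrDr lerD//; first exact: part.
by under eq_Rintegral do rewrite opprK; exact: part.
Qed.

End mixing_covariance.

Section mixing_mgf.
Context {R : realType} {d} {T : measurableType d}.
Variable P : probability T R.
Variables (zeta : nat -> T -> R) (a phi : nat -> R) (m : R).
Variables (G H : nat -> set (set T)).
Hypothesis mG : forall u, <<s G u >> `<=` measurable.
Hypothesis mH : forall t, <<s H t >> `<=` measurable.
Hypothesis zetaG : forall i u, (i <= u)%N ->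
  measurable_fun setT (zeta i : g_sigma_algebraType (G u) -> R).
Hypothesis zetaH : forall t,
  measurable_fun setT (zeta t : g_sigma_algebraType (H t) -> R).
Hypothesis m0 : 0 < m.
Hypothesis zetam : forall t w, `|zeta t w| <= m.
Hypothesis Ezeta : forall t, \int[P]_w zeta t w = 0.
Hypothesis phi0 : forall i, 0 <= phi i.
Hypothesis mix : forall u t A B, (u < t)%N -> <<s G u >> A -> <<s H t >> B ->
  fine (P (A `&` B)) <= fine (P A) * fine (P B) + phi (t - u) * fine (P A).
Hypothesis am : forall t, `|a t| * m <= 2^-1.

Let S t w := \sum_(i < t) a i * zeta i w.
Let b t := \int[P]_w expR (S t w).
(** Relative growth at time [t] of the bound on [b]: the second-order term of the new increment,
    then its covariances with the past. *)
Let gam t := 2 * (a t * m) ^+ 2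
  + 4 * m ^+ 2 * `|a t| * \sum_(u < t) phi (t - u) * `|a u|.

Let bzeta t : bounded_mfun (zeta t).
Proof. by split; [move=> _ B mB; apply: mH; exact: zetaH|exists m]. Qed.

Let bS t : bounded_mfun (S t).
Proof.
by apply: bounded_mfun_sum => i; exact: bounded_mfunZl.
Qed.

Let beS t : bounded_mfun (fun w => expR (S t w)).
Proof. exact: bounded_mfun_expR. Qed.

Let azeta t w : `|a t * zeta t w| <= 2^-1.
Proof. by apply: le_trans (am t); rewrite normrM ler_wpM2l. Qed.

Let step_increment u :
  \int[P]_w `|expR (S u.+1 w) - expR (S u w)| <= 2 * (`|a u| * m) * b u.
Proof.
rewrite -bounded_RintegralZl//; apply: bounded_le_Rintegral.
- exact/bounded_mfun_norm/bounded_mfunD/bounded_mfunN.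
- exact: bounded_mfunZl.
move=> w; rewrite {1}/S big_ord_recr/= expRD -/(S u w).
rewrite -[X in _ - X]mulr1 -mulrBr normrM ger0_norm ?expR_ge0// mulrC.
apply: ler_wpM2r; first exact: expR_ge0.
(* |exp x - 1| <= 2|x| for |x| <= 1/2. *)
apply: (@le_trans _ _ (2 * `|a u * zeta u w|)); last first.
  by rewrite normrM; apply: ler_wpM2l => //; exact: ler_wpM2l.
have := azeta u w; move: (a u * zeta u w) => x x2.
have x2' : x <= 2^-1 by exact: le_trans (ler_norm _) x2.
have := expR_le_1D2sqr x2'; have := expR_ge1Dx x.
move: x2; case: (ler0P x) => x0 x2 h1 h2; rewrite ler_norml; apply/andP; split; nra.
Qed.

(* Telescoping [exp S_t = 1 + sum_u (exp S_(u+1) - exp S_u)] against [zeta t]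
   reduces to the covariance inequality: no conditional expectation is needed. *)
Let step t : b t.+1 <= b t * (1 + 2 * (a t * m) ^+ 2)
  + 4 * m ^+ 2 * `|a t| * \sum_(u < t) phi (t - u) * `|a u| * b u.
Proof.
have bmul (f g : T -> R) (bf : bounded_mfun f) (bg : bounded_mfun g) :=
  bounded_mfunM bf bg.
apply: (@le_trans _ _ (\int[P]_w ((1 + 2 * (a t * m) ^+ 2) * expR (S t w) +
    a t * (expR (S t w) * zeta t w)))).
  apply: bounded_le_Rintegral => //.
    apply: bounded_mfunD; first exact: bounded_mfunZl.
    by apply: bounded_mfunZl; exact: bmul.
  move=> w; rewrite {1}/S big_ord_recr/= expRD -/(S t w).
  have -> : (1 + 2 * (a t * m) ^+ 2) * expR (S t w)
      + a t * (expR (S t w) * zeta t w) =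
    expR (S t w) * (1 + a t * zeta t w + 2 * (a t * m) ^+ 2) by ring.
  apply: ler_wpM2l; first exact: expR_ge0.
  have x2 : a t * zeta t w <= 2^-1 by exact: le_trans (ler_norm _) (azeta t w).
  apply: le_trans (expR_le_1D2sqr x2) _; rewrite lerD2l ler_wpM2l//.
  rewrite !exprMn ler_wpM2l ?sqr_ge0// -(real_normK (num_real (zeta t w))).
  by rewrite lerXn2r// nnegrE ltW.
rewrite bounded_RintegralD; last 2 first.
- exact: bounded_mfunZl.
- by apply: bounded_mfunZl; exact: bmul.
rewrite bounded_RintegralZl// mulrC lerD2l bounded_RintegralZl; last exact: bmul.
have -> : \int[P]_w (expR (S t w) * zeta t w) =
    \sum_(u < t) \int[P]_w ((expR (S u.+1 w) - expR (S u w)) * zeta t w).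
  rewrite -bounded_Rintegral_sum; last first.
    by move=> u; apply: bmul => //; exact/bounded_mfunD/bounded_mfunN.
  transitivity (\int[P]_w (zeta t w +
      \sum_(u < t) (expR (S u.+1 w) - expR (S u w)) * zeta t w)).
    apply: eq_Rintegral => w _; rewrite -mulr_suml -[X in X + _]mul1r -mulrDl.
    congr (_ * _).
    rewrite -(big_mkord xpredT (fun u => expR (S u.+1 w) - expR (S u w))).
    rewrite telescope_sumr// (_ : S 0 w = 0); last by rewrite /S big_ord0.
    by rewrite expR0 addrC subrK.
  rewrite bounded_RintegralD// ?Ezeta ?add0r//.
  apply: bounded_mfun_sum => u; apply: bmul => //.
  exact/bounded_mfunD/bounded_mfunN.
apply: le_trans (ler_norm _) _; rewrite normrM.
rewrite (_ : 4 * m ^+ 2 * `|a t| = `|a t| * (4 * m ^+ 2)); last by ring.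
rewrite -mulrA; apply: ler_wpM2l => //.
apply: le_trans (ler_norm_sum _ _ _) _; rewrite mulr_sumr; apply: ler_sum => u _.
have mGS i : (i <= u.+1)%N ->
    measurable_fun setT (S i : g_sigma_algebraType (G u) -> R).
  move=> iu; apply: measurable_sum => j; apply: measurable_funM => //.
  by apply: zetaG; rewrite -ltnS (leq_trans (ltn_ord j)).
have [C hC] := (bounded_mfunD (beS u.+1) (bounded_mfunN (beS u))).2.
have := @mixing_covariance_le _ _ _ P (G u) (H t) (phi (t - u)) (@mG u) (@mH t)
  (phi0 _) (fun A B => mix (ltn_ord u)) (fun w => expR (S u.+1 w) - expR (S u w))
  (zeta t) m C.
move=> /(_ _ _ hC m0 (zetam t) (Ezeta t)) /= h.
apply: le_trans (h _ (@zetaH t)) _.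
  by apply: measurable_funB; apply: measurableT_comp => //; exact: mGS.
apply: le_trans (ler_wpM2l _ (step_increment u)) _.
  by rewrite !mulr_ge0// ltW.
by rewrite le_eqVlt; apply/orP; left; apply/eqP; ring.
Qed.

Let gam0 t : 0 <= gam t.
Proof.
apply: addr_ge0; first by rewrite mulr_ge0// sqr_ge0.
rewrite mulr_ge0//; first by rewrite mulr_ge0// mulr_ge0// sqr_ge0.
by apply: sumr_ge0 => u _; exact: mulr_ge0.
Qed.

(** Strong induction, because [step] involves every earlier [b u]. As [gam] is nonnegative the
    bounds increase with time, so all of them are replaced by the one at [t], leaving the factor 1 +
    gam t <= exp(gam t). *)
Let b_le t : b t <= expR (\sum_(i < t) gam i).
Proof.
elim/ltn_ind: t => -[_|t IH].
  rewrite /b big_ord0 expR0; under eq_Rintegral do rewrite /S big_ord0 expR0.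
  by rewrite bounded_Rintegral_cst.
apply: le_trans (step t) _.
rewrite big_ord_recr/= expRD.
apply: (@le_trans _ _ (expR (\sum_(i < t) gam i) * (1 + gam t))); last first.
  by apply: ler_wpM2l; [exact: expR_ge0|exact: expR_ge1Dx].
rewrite [gam t]/gam [1 + (_ + _)]addrA [leRHS]mulrDr; apply: lerD.
  apply: ler_wpM2r; last exact: IH.
  by apply: addr_ge0 => //; rewrite mulr_ge0// sqr_ge0.
rewrite [leRHS]mulrCA; apply: ler_wpM2l; first by rewrite mulr_ge0// mulr_ge0// sqr_ge0.
rewrite [leRHS]mulr_sumr; apply: ler_sum => u _; rewrite [leRHS]mulrC.
apply: ler_wpM2l; first exact: mulr_ge0.
apply: le_trans (IH u (leqW (ltn_ord u))) _; rewrite ler_expR.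
rewrite -!(big_mkord xpredT gam) (big_cat_nat (leq0n u) (ltnW (ltn_ord u)))/=.
by rewrite lerDl; apply: sumr_ge0.
Qed.

(** The covariances form a quadratic form in |a_i| with kernel phi(i - u). By 2|a_i a_u| <= a_i^2 +
    a_u^2 it is controlled by the row sums ([half1]) and the column sums ([half2]) of the kernel,
    each at most [F]. *)
Lemma mixing_mgf_le N :
  \int[P]_w expR (\sum_(i < N) a i * zeta i w) <=
  expR (4 * (1 + \sum_(1 <= i < N.+1) phi i) * m ^+ 2 * \sum_(i < N) a i ^+ 2).
Proof.
apply: le_trans (b_le N) _; rewrite ler_expR /gam big_split/=.
set F := \sum_(1 <= i < N.+1) phi i.
have F0 : 0 <= F by apply: sumr_ge0.
have -> : \sum_(i < N) 2 * (a i * m) ^+ 2 = 2 * m ^+ 2 * \sum_(i < N) a i ^+ 2.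
  by rewrite mulr_sumr; apply: eq_bigr => i _; rewrite exprMn; ring.
have -> : \sum_(i < N) 4 * m ^+ 2 * `|a i| * (\sum_(u < i) phi (i - u) * `|a u|)
    = 4 * m ^+ 2 * \sum_(i < N) \sum_(u < i) phi (i - u) * (`|a i| * `|a u|).
  rewrite mulr_sumr; apply: eq_bigr => i _; rewrite -mulrA; congr (_ * _).
  by rewrite mulr_sumr; apply: eq_bigr => u _; ring.
have F_ge K : (K <= N.+1)%N -> \sum_(1 <= i < K) phi i <= F.
  move=> KN; have [K1|K1] := leqP K 1; first by rewrite big_geq.
  by rewrite /F (big_cat_nat (ltnW K1) KN)/= lerDl; apply: sumr_ge0.
have half1 : \sum_(i < N) \sum_(u < i) phi (i - u) * a i ^+ 2
    <= F * \sum_(i < N) a i ^+ 2.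
  rewrite mulr_sumr; apply: ler_sum => i _; rewrite -mulr_suml.
  apply: ler_wpM2r; first exact: sqr_ge0.
  apply: le_trans (F_ge i.+1 _); last by rewrite ltnS ltnW.
  (* The substitution u -> i - 1 - u turns the gaps i - u into 1, ..., i. *)
  rewrite big_add1/= big_mkord (reindex_inj rev_ord_inj)/=.
  by apply: ler_sum => u _; rewrite subKn.
have half2 : \sum_(i < N) \sum_(u < i) phi (i - u) * a u ^+ 2
    <= F * \sum_(i < N) a i ^+ 2.
  under eq_bigr => i _ do
    rewrite (big_ord_widen N (fun u => phi (i - u) * a u ^+ 2) (ltnW (ltn_ord i))).
  rewrite (exchange_big_dep xpredT)//= mulr_sumr; apply: ler_sum => u _.
  rewrite -mulr_suml; apply: ler_wpM2r; first exact: sqr_ge0.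
  rewrite -(big_geq_mkord u.+1 N xpredT (fun i => phi (i - u))).
  rewrite -add1n big_addn; apply: le_trans (F_ge (N - u)%N _).
    by apply: ler_sum => i _; rewrite addnK.
  by rewrite (leq_trans (leq_subr _ _)).
have cross : \sum_(i < N) \sum_(u < i) phi (i - u) * (`|a i| * `|a u|)
    <= F * \sum_(i < N) a i ^+ 2.
  suff : (\sum_(i < N) \sum_(u < i) phi (i - u) * (`|a i| * `|a u|)) * 2 <=
      F * \sum_(i < N) a i ^+ 2 + F * \sum_(i < N) a i ^+ 2 by lra.
  apply: (le_trans _ (lerD half1 half2)); rewrite -big_split/=.
  rewrite mulr_suml; apply: ler_sum => i _.
  rewrite mulr_suml -big_split/=; apply: ler_sum => u _.
  rewrite -mulrDr -mulrA ler_wpM2l//.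
  rewrite -(real_normK (num_real (a i))) -(real_normK (num_real (a u))).
  have := sqr_ge0 (`|a i| - `|a u|); nra.
have A0 : 0 <= \sum_(i < N) a i ^+ 2 by apply: sumr_ge0 => i _; exact: sqr_ge0.
have := ler_wpM2l (mulr_ge0 (ler0n R 4) (sqr_ge0 m)) cross.
have : 0 <= m ^+ 2 * \sum_(i < N) a i ^+ 2 by rewrite mulr_ge0 ?sqr_ge0.
move: (m ^+ 2) (\sum_(i < N) a i ^+ 2) => m2 A; nra.
Qed.

End mixing_mgf.

(* The noise is bounded only almost surely; clipping makes the bound hold
   everywhere without changing its law. *)
Definition clip {R : realType} (m x : R) : R := Num.max (- m) (Num.min m x).

Lemma clip_norm_le {R : realType} (m x : R) : 0 <= m -> `|clip m x| <= m.
Proof.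
move=> m0; rewrite ler_norml le_max lexx/= ge_max ge_min lexx/= andbT.
by rewrite (le_trans _ m0)// oppr_le0.
Qed.

Lemma clip_id {R : realType} (m x : R) : `|x| <= m -> clip m x = x.
Proof. by rewrite ler_norml => /andP[? ?]; rewrite /clip min_r// max_r. Qed.

Lemma measurable_clip {R : realType} (m : R) : measurable_fun setT (clip m).
Proof. by apply: measurable_maxr => //; exact: measurable_minr. Qed.

(** A set without a supremum has [sup] equal to 0 by convention. *)
Lemma sup_ge0 {R : realType} (E : set R) : (forall x, E x -> 0 <= x) -> 0 <= sup E.
Proof.
move=> E0; have [[[x Ex] ubE]|/sup_out->//] := pselect (has_sup E).
exact: le_trans (E0 x Ex) (ub_le_sup ubE Ex).
Qed.

Section phi_mixing_coefficients.
Context {R : realType} {d} {T : measurableType d}.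
Variable P : probability T R.

Let fine_prob_le1 A : measurable A -> 0 <= fine (P A) <= 1.
Proof.
move=> mA; rewrite fine_ge0//= -lee_fin fineK ?fin_num_measure//.
exact: probability_le1.
Qed.

Let phi_coef_set (A B : set (set T)) := [set x : R | exists E F,
  [/\ A E, B F, P E != 0%E &
    x = `|fine (P F) - fine (P (F `&` E)) / fine (P E)|]].

Let phi_coef_set_ub A B : A `<=` measurable -> B `<=` measurable ->
  ubound (phi_coef_set A B) 1.
Proof.
move=> mA mB _ [E [F [AE BF PE0 ->]]].
have mE := mA _ AE; have mF := mB _ BF.
have /andP[F0 F1] := fine_prob_le1 mF.
have E0 : 0 < fine (P E).
  by rewrite fine_gt0// lt0e PE0 measure_ge0/= -ge0_fin_numE ?fin_num_measure.
have q0 : 0 <= fine (P (F `&` E)) / fine (P E) by rewrite divr_ge0// fine_ge0.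
have q1 : fine (P (F `&` E)) / fine (P E) <= 1.
  rewrite ler_pdivrMr// mul1r fine_le ?fin_num_measure//; first exact: measurableI.
  by apply: le_measure; rewrite ?inE//; exact: measurableI.
by rewrite ler_norml; apply/andP; split; lra.
Qed.

Let phi_coef_set_neq0 A B : A setT -> B setT -> phi_coef_set A B !=set0.
Proof.
move=> AT BT; exists (`|fine (P setT) - fine (P (setT `&` setT)) / fine (P setT)|).
by exists setT, setT; split => //; rewrite probability_setT onee_neq0.
Qed.

Lemma phi_coef_ge0 A B : 0 <= phi_coef P A B.
Proof. by apply: sup_ge0 => _ [E [F [_ _ _ ->]]]. Qed.

Lemma phi_coef_le1 A B : A `<=` measurable -> B `<=` measurable ->
  A setT -> B setT -> phi_coef P A B <= 1.
Proof.
by move=> mA mB AT BT; apply: ge_sup; [exact: phi_coef_set_neq0|exact: phi_coef_set_ub].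
Qed.

(** The definition of the coefficient multiplied by P(E). When P(E) = 0, a case that the supremum
    leaves out, both sides vanish. *)
Lemma prob_setI_le_phi_coef A B E F : A `<=` measurable -> B `<=` measurable ->
  A E -> B F ->
  fine (P (E `&` F)) <= fine (P E) * fine (P F) + phi_coef P A B * fine (P E).
Proof.
move=> mA mB AE BF; have mE := mA _ AE; have mF := mB _ BF.
have [PE0|PE0] := eqVneq (P E) 0%E.
  have -> : P (E `&` F) = 0%E.
    apply/eqP; rewrite eq_le measure_ge0 andbT -PE0.
    by apply: le_measure; rewrite ?inE//; exact: measurableI.
  by rewrite PE0 /= mul0r mulr0 addr0.
have E0 : 0 < fine (P E).
  by rewrite fine_gt0// lt0e PE0 measure_ge0/= -ge0_fin_numE ?fin_num_measure.
have : `|fine (P F) - fine (P (F `&` E)) / fine (P E)| <= phi_coef P A B.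
  apply: ub_le_sup; first by exists 1; exact: phi_coef_set_ub.
  by exists E, F.
rewrite setIC ler_norml => /andP[h _].
rewrite -(ler_pM2r E0) in h; rewrite mulrBl -mulrA mulVf ?gt_eqF// mulr1 in h.
lra.
Qed.

Variable Z : int -> {RV P >-> R}.

Lemma sigma_family_RV_measurable D : sigma_family D Z `<=` measurable.
Proof.
apply: smallest_sub => //; first exact: sigma_algebra_measurable.
by move=> _ [i _] [B mB <-]; exact: measurable_funP.
Qed.

Let sigma_familyT D : sigma_family D Z setT.
Proof. by rewrite -setC0 -setTD; apply: sigma_algebraCD; exact: sigma_algebra0. Qed.

Let phi_mixing_ub i : has_ubound (range (fun t : int =>
    phi_coef P (sigma_family [set h | h <= t] Z)
               (sigma_family [set l | t + i%:Z <= l] Z))).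
Proof.
by exists 1 => _ [t _ <-]; apply: phi_coef_le1 => //; exact: sigma_family_RV_measurable.
Qed.

Lemma phi_mixing_ge0 i : 0 <= phi_mixing P Z i.
Proof. by apply: sup_ge0 => _ [t _ <-]; exact: phi_coef_ge0. Qed.

Lemma phi_mixing_le1 i : phi_mixing P Z i <= 1.
Proof.
apply: ge_sup; first by exists (phi_coef P (sigma_family [set h | h <= 0] Z)
  (sigma_family [set l | 0 + i%:Z <= l] Z)), 0.
by move=> _ [t _ <-]; apply: phi_coef_le1 => //; exact: sigma_family_RV_measurable.
Qed.

Lemma prob_setI_le_phi_mixing (t : int) i E F :
  sigma_family [set h | h <= t] Z E ->
  sigma_family [set l | t + i%:Z <= l] Z F ->
  fine (P (E `&` F)) <= fine (P E) * fine (P F) + phi_mixing P Z i * fine (P E).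
Proof.
move=> sE sF.
apply: le_trans (prob_setI_le_phi_coef _ _ sE sF) _.
- exact: sigma_family_RV_measurable.
- exact: sigma_family_RV_measurable.
rewrite lerD2l; apply: ler_wpM2r.
  exact: fine_ge0.
by apply: ub_le_sup => //; exists t.
Qed.

Lemma clip_mixing_mgf_le N (m : R) (a : 'I_N -> R) : 0 < m ->
  (forall t : 'I_N, \int[P]_w clip m (Z t.+1%:Z w) = 0) ->
  (forall t, `|a t| * m <= 2^-1) ->
  \int[P]_w expR (\sum_(t < N) a t * clip m (Z t.+1%:Z w)) <=
  expR (4 * Phi_mixing P Z N * m ^+ 2 * \sum_(t < N) a t ^+ 2).
Proof.
move=> m0 EZ am.
(* Step [t] of the recursion reads the process at time t + 1, so past and future are cut there and
   the gaps t - u are unchanged. Variables and coefficients are extended by 0 beyond [N]. *)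
pose zeta t w := if (t < N)%N then clip m (Z t.+1%:Z w) else 0.
pose a' t := oapp a 0 (insub t).
pose gen (D : set int) := \bigcup_(i in D) preimage_set_system setT (Z i) measurable.
have mgen (D : set int) i : D i ->
    measurable_fun setT (Z i : g_sigma_algebraType (gen D) -> R).
  move=> Di _ B mB; apply: sub_sigma_algebra; exists i => //; exists B => //.
have mzeta (D : set int) t : D t.+1%:Z ->
    measurable_fun setT (zeta t : g_sigma_algebraType (gen D) -> R).
  move=> Dt; rewrite /zeta; case: ltnP => _; last exact: measurable_cst.
  by apply: measurableT_comp; [exact: measurable_clip|exact: mgen].
have := @mixing_mgf_le _ _ _ P zeta a' (phi_mixing P Z) m
  (fun u => gen [set h | h <= u.+1%:Z]) (fun t => gen [set l | t.+1%:Z <= l]).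
move=> /(_ _ _ _ _ m0 _ _ phi_mixing_ge0 _ _ N) H.
have {}H : \int[P]_w expR (\sum_(i < N) a' i * zeta i w) <=
    expR (4 * (1 + \sum_(1 <= i < N.+1) phi_mixing P Z i) * m ^+ 2
      * \sum_(i < N) a' i ^+ 2).
  apply: H.
  - by move=> u; exact: sigma_family_RV_measurable.
  - by move=> t; exact: sigma_family_RV_measurable.
  - by move=> i u iu; apply: mzeta; rewrite /= lez_nat ltnS.
  - by move=> t; apply: mzeta => /=.
  - move=> t w; rewrite /zeta; case: ifP => _; first exact: clip_norm_le (ltW m0).
    by rewrite normr0 ltW.
  - move=> t; rewrite /zeta; case: ltnP => tN; first exact: EZ (Ordinal tN).
    by rewrite bounded_Rintegral_cst.
  - move=> u t A B ut sA sB; apply: (@prob_setI_le_phi_mixing u.+1%:Z) => //.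
    by rewrite -PoszD addSn subnKC ?(ltnW ut).
  - move=> t; rewrite /a'; case: insubP => [i _ _|_] /=; first exact: am.
    by rewrite normr0 mul0r invr_ge0.
have a'E (i : 'I_N) : a' i = a i by rewrite /a' valK.
have -> : \int[P]_w expR (\sum_(t < N) a t * clip m (Z t.+1%:Z w)) =
    \int[P]_w expR (\sum_(i < N) a' i * zeta i w).
  apply: eq_Rintegral => w _; congr expR; apply: eq_bigr => i _.
  by rewrite a'E /zeta ltn_ord.
apply: le_trans H _; rewrite ler_expR.
have -> : \sum_(i < N) a' i ^+ 2 = \sum_(i < N) a i ^+ 2.
  by apply: eq_bigr => i _; rewrite a'E.
apply: ler_wpM2r; first by apply: sumr_ge0 => i _; exact: sqr_ge0.
apply: ler_wpM2r; first exact: sqr_ge0.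
apply: ler_wpM2l => //; rewrite /Phi_mixing lerD2l; apply: ler_sum => i _.
have p0 := phi_mixing_ge0 i.
(* As phi <= 1, phi <= sqrt phi: the square roots in [Phi_mixing] dominate the coefficients
   themselves. *)
rewrite -[leLHS]sqr_sqrtr// expr2 ler_piMl ?sqrtr_ge0//.
by rewrite -sqrtr1 ler_wsqrtr// phi_mixing_le1.
Qed.

End phi_mixing_coefficients.

(** * Sampling *)

Section measurable_matrices.
Context {R : realType} {d} {Omega : measurableType d}.

Lemma measurable_mx_entry m n (i : 'I_m) (j : 'I_n) :
  measurable_fun setT (fun A : 'M[R]_(m, n) => A i j).
Proof.
move=> _ B mB; apply: sub_sigma_algebra; exists (i, j) => //.
by exists B.
Qed.

Lemma measurable_fun_mx m n (f : Omega -> 'M[R]_(m, n)) :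
  (forall i j, measurable_fun setT (fun w => f w i j)) -> measurable_fun setT f.
Proof.
move=> mf; apply: (@measurability _ _ _ _ _ _
  (\bigcup_(ij in [set: 'I_m * 'I_n]) preimage_set_system setT
     (fun A : 'M[R]_(m, n) => A ij.1 ij.2) measurable)) => //.
move=> _ [_ [[i j] _ [B mB <-]] <-].
by rewrite setTI; exact: mf.
Qed.

Lemma measurable_mx1 m n (A : 'M[R]_(m, n)) : measurable [set A].
Proof.
have -> : [set A] = \bigcap_(ij in [set: 'I_m * 'I_n])
    ((fun M : 'M[R]_(m, n) => M ij.1 ij.2) @^-1` [set A ij.1 ij.2]).
  apply/seteqP; split => [_ -> [i j] _ //|M MA].
  by apply/matrixP => i j; exact: (MA (i, j)).
apply: fin_bigcap_measurable => [|ij _]; first exact: finite_finset.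
by rewrite -[X in measurable X]setTI; exact: measurable_mx_entry.
Qed.

Lemma measurable_row m n (f : Omega -> 'M[R]_(m, n)) i :
  measurable_fun setT f -> measurable_fun setT (fun w => row i (f w)).
Proof.
move=> mf; apply: measurable_fun_mx => k j.
under eq_fun do rewrite mxE.
by apply: (measurableT_comp (measurable_mx_entry i j)).
Qed.

End measurable_matrices.

Section same_law_integral.
Context {R : realType} {d1 d2 d'} {T1 : measurableType d1}
  {T2 : measurableType d2} {T' : measurableType d'}.

Lemma same_law_integral (P1 : probability T1 R) (P2 : probability T2 R)
    (Y1 : T1 -> T') (Y2 : T2 -> T') (f : T' -> \bar R) :
  measurable_fun setT Y1 -> measurable_fun setT Y2 -> same_law P1 P2 Y1 Y2 ->
  measurable_fun setT f -> (forall y, 0 <= f y)%E ->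
  (\int[P1]_w f (Y1 w) = \int[P2]_w f (Y2 w))%E.
Proof.
move=> mY1 mY2 Y12 mf f0.
rewrite -[LHS](@ge0_integral_pushforward _ _ _ _ _ _ mY1 P1 setT f)//.
rewrite -[RHS](@ge0_integral_pushforward _ _ _ _ _ _ mY2 P2 setT f)//.
by apply: eq_measure_integral => B mB _; exact: Y12.
Qed.

End same_law_integral.

Section sampling.
Context {R : realType} {d T : nat}.
Variable Pi : probability 'M[R]_(d, T) R.
Hypothesis hPi : Pi sampling_set = 1%E.

Definition sampling_weight (p : 'I_d * 'I_T) : R := fine (Pi [set delta_mx p.1 p.2]).

Lemma sampling_weight_ge0 p : 0 <= sampling_weight p.
Proof. exact: fine_ge0. Qed.

Lemma delta_mx_inj (p q : 'I_d * 'I_T) :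
  delta_mx p.1 p.2 = delta_mx q.1 q.2 :> 'M[R]_(d, T) -> p = q.
Proof.
move=> /matrixP/(_ p.1 p.2); rewrite !mxE !eqxx.
case: p q => [j t] [j' t'] /=.
by case: eqP => [->|_]; case: eqP => [->|_] //= /eqP; rewrite oner_eq0.
Qed.

Lemma measurable_sampling_set : measurable (sampling_set : set 'M[R]_(d, T)).
Proof.
have -> : sampling_set =
    \bigcup_(p in [set: 'I_d * 'I_T]) [set delta_mx p.1 p.2 : 'M[R]_(d, T)].
  apply/seteqP; split => [_ [j [t ->]]|_ [[j t] _ ->]]; first by exists (j, t).
  by exists j, t.
apply: fin_bigcup_measurable => [|p _]; first exact: finite_finset.
exact: measurable_mx1.
Qed.

(** [Pi] charges only the finitely many matrix units, so [f] may be replaced almost everywhere by a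
    finite combination of indicators of singletons. *)
Lemma sampling_integral (f : 'M[R]_(d, T) -> R) :
  measurable_fun setT f -> (forall A, 0 <= f A) ->
  (\int[Pi]_A (f A)%:E =
   (\sum_p sampling_weight p * f (delta_mx p.1 p.2))%:E)%E.
Proof.
move=> mf f0.
pose g (A : 'M[R]_(d, T)) : R := \sum_p \1_[set delta_mx p.1 p.2] A * f (delta_mx p.1 p.2).
have m1 p : measurable [set delta_mx p.1 p.2 : 'M[R]_(d, T)] by exact: measurable_mx1.
have gE A : sampling_set A -> g A = f A.
  move=> [j [t ->]]; rewrite /g (bigD1 (j, t))//= indicE mem_set// mul1r.
  rewrite big1 ?addr0// => q qjt; rewrite indicE memNset ?mul0r//=.
  by move=> h; move: qjt; rewrite -(@delta_mx_inj (j, t) q h) eqxx.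
have msamp : measurable (sampling_set : set 'M[R]_(d, T)) by exact: measurable_sampling_set.
have mg : measurable_fun setT g.
  by apply: measurable_sum => p; apply: measurable_funM => //; exact: measurable_indic.
transitivity (\int[Pi]_A (g A)%:E)%E.
  apply: ae_eq_integral => //; [exact/measurable_EFinP|exact/measurable_EFinP|].
  exists (~` sampling_set); split; first exact: measurableC.
    by rewrite /= probability_setC// hPi subee.
  move=> A /= h; apply: contra_not h => sA _; by rewrite gE.
rewrite /g; under eq_integral do rewrite -sumEFin.
rewrite ge0_integral_sum//.
- rewrite -sumEFin; apply: eq_bigr => p _.
  under eq_integral do rewrite EFinM muleC.
  rewrite ge0_integralZl//=.
  + rewrite integral_indic// setIT /sampling_weight EFinM muleC fineK//.
    exact: fin_num_measure.
  + by apply/measurable_EFinP; exact: measurable_indic.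
  + by rewrite lee_fin.
- by move=> p; apply/measurable_EFinP; apply: measurable_funM => //; exact: measurable_indic.
- by move=> p A _; rewrite lee_fin mulr_ge0.
Qed.

Lemma sampling_weight_sum : \sum_p sampling_weight p = 1.
Proof.
have : (\int[Pi]_A (cst 1%:E A) = (\sum_p sampling_weight p * 1)%:E)%E.
  exact: (sampling_integral (f := cst 1)).
rewrite integral_cst//= probability_setT mule1 => -[->].
by apply: eq_bigr => p _; rewrite mulr1.
Qed.

Lemma frob_delta (j : 'I_d) (t : 'I_T) (A : 'M[R]_(d, T)) :
  frob (delta_mx j t) A = A j t.
Proof.
rewrite /frob trmx_delta /mxtrace (bigD1 t)//= mxE (bigD1 j)//= mxE !eqxx mul1r.
rewrite big1 ?addr0; last by move=> k kj; rewrite mxE (negbTE kj) andbF mul0r.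
rewrite big1 ?addr0// => k kt; rewrite mxE big1// => l _.
by rewrite mxE (negbTE kt) mul0r.
Qed.

Lemma measurable_frob (A : 'M[R]_(d, T)) :
  measurable_fun setT (fun X : 'M[R]_(d, T) => frob X A).
Proof.
rewrite /frob /mxtrace; apply: measurable_sum => t.
under eq_fun do rewrite mxE; apply: measurable_sum => j.
under eq_fun do rewrite mxE; apply: measurable_funM => //.
exact: measurable_mx_entry.
Qed.

Lemma normFPi2E (A : 'M[R]_(d, T)) :
  normFPi2 Pi A = \sum_p sampling_weight p * A p.1 p.2 ^+ 2.
Proof.
rewrite /normFPi2 /Rintegral (sampling_integral (f := fun X => frob X A ^+ 2)).
- by apply: eq_bigr => p _; rewrite frob_delta.
- by apply: measurable_funX; exact: measurable_frob.
- by move=> X; exact: sqr_ge0.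
Qed.

End sampling.

(** * Laplace transform of the excess loss *)

Section independence_helpers.
Context {R : realType} {d} {Omega : measurableType d} (P : probability Omega R).

Lemma mutual_independence_setT {I : finType} (F : I -> set (set Omega))
    (E : I -> set Omega) :
  mutual_independence P F -> (forall i, F i (E i)) ->
  fine (P (\bigcap_i E i)) = \prod_i fine (P (E i)).
Proof.
move=> /(_ [set: I]%SET E) h FE.
have {}h := h (fun i _ => FE i).
have <- : \bigcap_(i in [set` [set: I]%SET]) E i = \bigcap_i E i.
  apply/seteqP; split => w hw i _; first by apply: hw; rewrite /= inE.
  exact: hw.
by rewrite h; apply: eq_bigl => i; rewrite inE.
Qed.

Lemma sigma_family_bigcap {I : finType} {d'} {T' : measurableType d'}
    (f : I -> Omega -> T') (B : I -> set T') :
  (forall i, measurable (B i)) ->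
  sigma_family setT f (\bigcap_i (f i @^-1` B i)).
Proof.
move=> mB; rewrite /sigma_family.
set G := \bigcup_(i in _) _.
have mf i : (measurable : set (set (g_sigma_algebraType G))) (f i @^-1` B i).
  apply: sub_sigma_algebra; exists i => //; exists (B i) => //.
  by rewrite setTI.
exact: (@fin_bigcap_measurable _ (g_sigma_algebraType G) _ setT _
  finite_finset (fun i _ => mf i)).
Qed.

(** The second and third events are swapped so that the first two factors of the intersection form
    the event [G] of [integral_prod_comp_le], the noise [xi] being the family integrated there. *)
Lemma mutual_independence3 (F1 F2 F3 : set (set Omega)) E1 E2 E3 :
  mutual_independence P (tnth [tuple F1; F2; F3]) -> F1 E1 -> F2 E2 -> F3 E3 ->
  fine (P (E1 `&` E3 `&` E2)) = fine (P E1) * fine (P E3) * fine (P E2).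
Proof.
move=> h e1 e2 e3.
have := mutual_independence_setT (E := tnth [tuple E1; E2; E3]) h.
rewrite !big_ord_recl big_ord0 mulr1 !(tnth_nth set0)/=.
have -> : \bigcap_i tnth [tuple E1; E2; E3] i = E1 `&` E3 `&` E2.
  apply/seteqP; split => w.
    move=> hw; have := hw ord0 I; have := hw (lift ord0 ord0) I.
    by have := hw (lift ord0 (lift ord0 ord0)) I; rewrite !(tnth_nth set0)/=.
  move=> [[w1 w3] w2] [[|[|[|//]]] hi] _; rewrite (tnth_nth set0)//.
move=> ->; first by rewrite mulrAC mulrA.
by move=> [[|[|[|//]]] hi]; rewrite !(tnth_nth set0).
Qed.

End independence_helpers.

Section laplace.
Context {R : realType} {d T n : nat} {disp} {Omega : measurableType disp}.
Variables (P : probability Omega R) (Pi : probability 'M[R]_(d, T) R).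
Variables (X : 'I_n -> {RV P >-> 'M[R]_(d, T)}) (xi : 'I_n -> {RV P >-> R}).
Variable eps : {RV P >-> 'M[R]_(d, T)}.
Hypothesis hPi : Pi sampling_set = 1%E.
Hypothesis hX_indep : independent_rvs P X.
Hypothesis hX_law : forall i B, measurable B -> distribution P (X i) B = Pi B.
Hypothesis hxi_indep : independent_rvs P xi.
Hypothesis hindep : mutual_independence P
  (tnth [tuple sigma_family setT X; sigma_family setT xi;
               preimage_set_system setT eps measurable]).

Implicit Types (x : {ffun 'I_n -> 'I_d * 'I_T}) (D : 'M[R]_(d, T)).

Definition sampled x : set Omega :=
  \bigcap_i (X i @^-1` [set delta_mx (x i).1 (x i).2]).

Lemma measurable_sampled x : measurable (sampled x).
Proof.
apply: fin_bigcap_measurable => [|i _]; first exact: finite_finset.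
by rewrite -[X in measurable X]setTI; apply: measurable_funP => //; exact: measurable_mx1.
Qed.

(** All independence needed for [X], [xi] and [eps] in the Laplace bound enters here: between the
    three families, within [X] and within [xi]. *)
Lemma prob_sampled_eps_xi x C (B : 'I_n -> set R) :
  measurable C -> (forall i, measurable (B i)) ->
  fine (P (sampled x `&` eps @^-1` C `&` \bigcap_i (xi i @^-1` B i))) =
  \prod_i sampling_weight Pi (x i) * fine (P (eps @^-1` C)) *
  \prod_i fine (P (xi i @^-1` B i)).
Proof.
move=> mC mB; rewrite (mutual_independence3 hindep).
- congr (_ * _ * _).
    rewrite /sampled (mutual_independence_setT hX_indep).
      apply: eq_bigr => i _; rewrite /sampling_weight -(hX_law i)//.
      exact: measurable_mx1.
    move=> i; exists [set delta_mx (x i).1 (x i).2]; first exact: measurable_mx1.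
    by rewrite setTI.
  rewrite (mutual_independence_setT hxi_indep)// => i.
  by exists (B i) => //; rewrite setTI.
- by apply: sigma_family_bigcap => i; exact: measurable_mx1.
- exact: sigma_family_bigcap.
- by exists C => //; rewrite setTI.
Qed.

Variables (m0 m v c cPi s Phi : R).
Hypothesis m_gt0 : 0 < m.
Hypothesis c_gt0 : 0 < c.
Hypothesis v_gt0 : 0 < v.
Hypothesis hmgf : forall i u, `|u| * c <= 6^-1 ->
  (\int[P]_w (expR (u * xi i w))%:E <= (1 + 2 * u ^+ 2 * v)%:E)%E.
Hypothesis hrows : forall a : 'I_d -> 'I_T -> R, (forall j t, `|a j t| * m <= 2^-1) ->
  (\int[P]_w (expR (\sum_j \sum_t a j t * clip m (eps w j t)))%:E <=
   (expR (4 * Phi * m ^+ 2 * \sum_j \sum_t a j t ^+ 2))%:E)%E.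
Hypothesis hPi_bound : forall j t,
  (Pi [set delta_mx j t] <= (cPi / (d * T)%:R)%:E)%E.

(* The sampling matrices take finitely many values, so that splitting over the
   events [sampled x] replaces conditioning on them.  On [sampled x] this is the
   exponential of [s] times the excess loss, with clipped noise. *)
Definition tilted_loss D w : R := \sum_x (\1_(sampled x) w *
  expR (\sum_i s * (D (x i).1 (x i).2 ^+ 2
    - 2 * (clip m (eps w (x i).1 (x i).2) + xi i w) * D (x i).1 (x i).2))).

Let measurable_tilted_term D x : measurable_fun setT (fun w => \1_(sampled x) w *
  expR (\sum_i s * (D (x i).1 (x i).2 ^+ 2
    - 2 * (clip m (eps w (x i).1 (x i).2) + xi i w) * D (x i).1 (x i).2)) : R).
Proof.
apply: measurable_funM.
  by apply: measurable_indic; exact: measurable_sampled.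
apply: measurableT_comp => //; apply: measurable_sum => i.
apply: measurable_funM => //; apply: measurable_funB => //.
apply: measurable_funM => //; apply: measurable_funM => //.
apply: measurable_funD => //; apply: measurableT_comp; first exact: measurable_clip.
exact: (measurableT_comp (measurable_mx_entry _ _)).
Qed.

Lemma measurable_tilted_loss D : measurable_fun setT (tilted_loss D).
Proof. by apply: measurable_sum => x; exact: measurable_tilted_term. Qed.

Lemma tilted_loss_ge0 D w : 0 <= tilted_loss D w.
Proof. by apply: sumr_ge0 => x _; rewrite mulr_ge0 ?expR_ge0// indicE. Qed.

(** For a fixed design [x], each [xi i] contributes its moment generating function bound and the
    design its product probability, with [eps] kept. The sum over all n-tuples of positions of a
    product of n equal functions of the position is then an n-th power. *)
Lemma integral_tilted_loss_le D :
  (forall j t, `|2 * s * D j t| * c <= 6^-1) ->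
  (\int[P]_w (tilted_loss D w)%:E <=
   \int[P]_w ((\sum_p sampling_weight Pi p * (1 + 2 * (2 * s * D p.1 p.2) ^+ 2 * v) *
     expR (s * (D p.1 p.2 ^+ 2 - 2 * clip m (eps w p.1 p.2) * D p.1 p.2))) ^+ n)%:E)%E.
Proof.
move=> hs.
(* At position [p], [u p] is the coefficient of [xi] in the exponent, [h p] the part free of [xi],
   and [e p] the bound on the moment generating function at [u p]. *)
pose u (p : 'I_d * 'I_T) := - (2 * s * D p.1 p.2).
pose h p (E : 'M[R]_(d, T)) :=
  s * (D p.1 p.2 ^+ 2 - 2 * clip m (E p.1 p.2) * D p.1 p.2).
pose e p := 1 + 2 * (u p) ^+ 2 * v.
have mh p : measurable_fun setT (h p).
  apply: measurable_funM => //; apply: measurable_funB => //.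
  apply: measurable_funM => //; apply: measurable_funM => //.
  by apply: measurableT_comp; [exact: measurable_clip|exact: measurable_mx_entry].
have mg x : measurable_fun setT (fun E => expR (\sum_i h (x i) E)).
  by apply: measurableT_comp => //; apply: measurable_sum => i; exact: mh.
have e0 p : 0 <= e p by rewrite addr_ge0// mulr_ge0 ?(ltW v_gt0)// mulr_ge0// sqr_ge0.
have one x : (\int[P]_w (\1_(sampled x) w * expR (\sum_i s * (D (x i).1 (x i).2 ^+ 2
    - 2 * (clip m (eps w (x i).1 (x i).2) + xi i w) * D (x i).1 (x i).2)))%:E <=
  \int[P]_w (\prod_i (sampling_weight Pi (x i) * e (x i) * expR (h (x i) (eps w))))%:E)%E.
  pose W1 w := \1_(sampled x) w * \prod_i expR (u (x i) * xi i w).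
  pose c1 := \prod_i sampling_weight Pi (x i) * \prod_i e (x i).
  have c10 : 0 <= c1.
    by rewrite mulr_ge0//; apply: prodr_ge0 => i _ //; exact: sampling_weight_ge0.
  have W10 w : 0 <= W1 w.
    by rewrite mulr_ge0 ?indicE//; apply: prodr_ge0 => i _; exact: expR_ge0.
  have mW1 : measurable_fun setT W1.
    apply: measurable_funM; first by apply: measurable_indic; exact: measurable_sampled.
    by apply: measurable_prod => i _; apply: measurableT_comp => //; exact: measurable_funM.
  pose g E := (expR (\sum_i h (x i) E))%:E.
  apply: (@le_trans _ _ (\int[P]_w ((EFin \o W1) w * g (eps w)))%E).
    rewrite le_eqVlt; apply/orP; left; apply/eqP.
    apply: eq_integral => w _ /=; rewrite /g -EFinM; congr EFin.
    rewrite /W1 -mulrA; congr (_ * _); rewrite -expR_sum -expRD -big_split/=.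
    by congr expR; apply: eq_bigr => i _; rewrite /u /h; ring.
  apply: (@le_trans _ _ (\int[P]_w (cst c1%:E w * g (eps w)))%E); last first.
    rewrite le_eqVlt; apply/orP; left; apply/eqP.
    apply: eq_integral => w _; rewrite /g -EFinM; congr EFin.
    by rewrite !big_split/= -expR_sum.
  apply: le_integral_mul_comp.
  - exact/measurable_EFinP.
  - exact: measurable_cst.
  - by move=> w /=; rewrite lee_fin.
  - by move=> w /=; rewrite lee_fin.
  - exact: measurable_funP.
  - exact/measurable_EFinP.
  - by move=> E; rewrite lee_fin expR_ge0.
  - move=> C mC.
    have mepsC : measurable (eps @^-1` C).
      by rewrite -[X in measurable X]setTI; exact: measurable_funP.
    rewrite integral_cst// integral_mkcond.
    apply: (@le_trans _ _ (\int[P]_w (\1_(sampled x `&` eps @^-1` C) w *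
        \prod_i expR (u (x i) * xi i w))%:E)%E).
      rewrite le_eqVlt; apply/orP; left; apply/eqP.
      apply: eq_integral => w _; rewrite patchE /W1/= indicI/=.
      rewrite [\1_(eps @^-1` C) w]indicE; case: (w \in _); rewrite ?mulr1//.
      by rewrite mulr0 mul0r.
    apply: le_trans (integral_prod_comp_le
      (p := \prod_i sampling_weight Pi (x i) * fine (P (eps @^-1` C)))
      (g := fun i y => expR (u (x i) * y)) (e := fun i => e (x i)) _ _ _ _ _ _ _) _.
    + by apply: measurableI => //; exact: measurable_sampled.
    + by move=> i; exact: measurable_funP.
    + rewrite mulr_ge0 ?fine_ge0//.
      by apply: prodr_ge0 => i _ //; exact: sampling_weight_ge0.
    + by move=> B mB; exact: prob_sampled_eps_xi.
    + by move=> i; apply: measurableT_comp => //; exact: measurable_funM.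
    + by move=> i y; exact: expR_ge0.
    + by move=> i; apply: hmgf; rewrite /u normrN; exact: hs.
    by rewrite mulrAC EFinM fineK ?fin_num_measure.
rewrite /tilted_loss; under eq_integral do rewrite -sumEFin.
rewrite ge0_integral_sum//; last first.
  by move=> x; apply/measurable_EFinP; exact: measurable_tilted_term.
apply: le_trans (lee_sum _ (fun x _ => one x)) _.
rewrite -ge0_integral_sum//; last 2 first.
- move=> x; apply/measurable_EFinP; apply: measurable_prod => i _.
  apply: measurable_funM => //; apply: measurableT_comp => //.
  by apply: measurableT_comp; [exact: mh|exact: measurable_funP].
- move=> x w _; rewrite lee_fin; apply: prodr_ge0 => i _.
  by rewrite mulr_ge0 ?expR_ge0// mulr_ge0// sampling_weight_ge0.
rewrite le_eqVlt; apply/orP; left; apply/eqP; apply: eq_integral => w _.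
rewrite sumEFin; congr EFin.
rewrite -[in RHS](card_ord n) -prodr_const bigA_distr_bigA/=.
apply: eq_bigr => x _; apply: eq_bigr => i _.
by rewrite /e /u sqrrN.
Qed.

(** 1 + 8 v s^2 x^2 <= exp(8 v s^2 x^2) merges the contribution of [xi] with the exponent into one
    [z], with |z| <= 1/2, to which exp z <= 1 + z + 2 z^2 applies. The noise [y] is kept exactly in
    the linear term, to be averaged later, and bounded in the square. *)
Let factor_le B (x y : R) : `|y| <= m -> 0 <= B -> `|x - 2 * y + 8 * v * s * x| <= B ->
  `|s| * `|x| * B <= 2^-1 ->
  (1 + 2 * (2 * s * x) ^+ 2 * v) * expR (s * (x ^+ 2 - 2 * y * x)) <=
  1 + (s * x ^+ 2 - 2 * s * y * x + (8 * v + 2 * B ^+ 2) * s ^+ 2 * x ^+ 2).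
Proof.
move=> ym B0 hB sB.
pose z := s * x * (x - 2 * y + 8 * v * s * x).
apply: (@le_trans _ _ (expR z)).
  have -> : z = 2 * (2 * s * x) ^+ 2 * v + s * (x ^+ 2 - 2 * y * x) by rewrite /z; ring.
  by rewrite expRD ler_wpM2r ?expR_ge0// expR_ge1Dx.
have zB : `|z| <= `|s| * `|x| * B by rewrite /z !normrM ler_wpM2l// mulr_ge0.
have z2 : z <= 2^-1 by rewrite (le_trans (ler_norm _))// (le_trans zB).
apply: le_trans (expR_le_1D2sqr z2) _.
have : z ^+ 2 <= s ^+ 2 * x ^+ 2 * B ^+ 2.
  rewrite /z !exprMn ler_wpM2l ?(mulr_ge0 (sqr_ge0 _) (sqr_ge0 _))//.
  by rewrite -(real_normK (num_real (x - 2 * y + 8 * v * s * x))) lerXn2r// nnegrE.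
have -> : z = s * x ^+ 2 - 2 * s * y * x + 8 * v * s ^+ 2 * x ^+ 2 by rewrite /z; ring.
move: (_ ^+ 2) => z'; move: (s ^+ 2) (x ^+ 2) (B ^+ 2) => s2 x2 B2 h.
rewrite -addrA lerD2l -addrA lerD2l.
by rewrite [leRHS](_ : _ = 8 * v * s2 * x2 + 2 * (s2 * x2 * B2)); [lra|ring].
Qed.

Variable Dm : R.
(** Bounds the factor x - 2 y + 8 v s x of [factor_le] when |x| <= Dm, |y| <= m and |s| <= 1. *)
Let B := Dm + 2 * m + 8 * v * Dm.
Hypothesis Dm_gt0 : 0 < Dm.
Hypothesis cPi_gt0 : 0 < cPi.
Hypothesis Phi_ge0 : 0 <= Phi.
Hypothesis n_gt0 : (0 < n)%N.
Hypothesis n_le : (n <= d * T)%N.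
Hypothesis s_le1 : `|s| <= 1.
Hypothesis sB : `|s| * Dm * B <= 2^-1.
Hypothesis sc : 12 * `|s| * Dm * c <= 1.
Hypothesis sPi : 4 * `|s| * cPi * Dm * m <= 1.

Lemma laplace_le D : (forall j t, `|D j t| <= Dm) ->
  (\int[P]_w (tilted_loss D w)%:E <=
   (expR (n%:R * (s * normFPi2 Pi D
     + (8 * v + 2 * B ^+ 2 + 16 * Phi * m ^+ 2 * cPi) * s ^+ 2 * normFPi2 Pi D)))%:E)%E.
Proof.
move=> hD.
have B0 : 0 <= B by rewrite /B !addr_ge0 ?mulr_ge0 ?ltW.
have cs j t : `|2 * s * D j t| * c <= 6^-1.
  rewrite !normrM ger0_norm//.
  have : `|s| * `|D j t| * c <= `|s| * Dm * c.
    by rewrite ler_wpM2r ?(ltW c_gt0)// ler_wpM2l.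
  by move: sc; lra.
apply: le_trans (integral_tilted_loss_le cs) _.
set N := normFPi2 Pi D.
pose a j t := - (2 * s * n%:R * sampling_weight Pi (j, t) * D j t).
pose K1 := 8 * v + 2 * B ^+ 2.
have mclip p : measurable_fun setT (fun w => clip m (eps w p.1 p.2)).
  apply: measurableT_comp; first exact: measurable_clip.
  exact: (measurableT_comp (measurable_mx_entry _ _)).
have sw0 p := sampling_weight_ge0 Pi p.
(* Here [eps w] is still frozen. The exponent splits into a deterministic part and the linear form
   in the clipped noise with coefficients [a]. *)
have pointwise w : (\sum_p sampling_weight Pi p * (1 + 2 * (2 * s * D p.1 p.2) ^+ 2 * v) *
     expR (s * (D p.1 p.2 ^+ 2 - 2 * clip m (eps w p.1 p.2) * D p.1 p.2))) ^+ n <=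
   expR (n%:R * (s * N + K1 * s ^+ 2 * N)) *
   expR (\sum_j \sum_t a j t * clip m (eps w j t)).
  pose z p := s * D p.1 p.2 ^+ 2 - 2 * s * clip m (eps w p.1 p.2) * D p.1 p.2
     + K1 * s ^+ 2 * D p.1 p.2 ^+ 2.
  have le_z : \sum_p sampling_weight Pi p * (1 + 2 * (2 * s * D p.1 p.2) ^+ 2 * v) *
     expR (s * (D p.1 p.2 ^+ 2 - 2 * clip m (eps w p.1 p.2) * D p.1 p.2))
     <= expR (\sum_p sampling_weight Pi p * z p).
    apply: le_trans (expR_ge1Dx _).
    rewrite -[X in X + _](sampling_weight_sum hPi) -big_split/=.
    apply: ler_sum => p _.
    have -> : sampling_weight Pi p + sampling_weight Pi p * z p =
      sampling_weight Pi p * (1 + z p) by rewrite [RHS]mulrDr mulr1.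
    rewrite -mulrA ler_wpM2l//.
    have ym : `|clip m (eps w p.1 p.2)| <= m by exact: clip_norm_le (ltW m_gt0).
    apply: factor_le => //.
      move: ym (hD p.1 p.2); set y := clip _ _; set x := D _ _ => ym xD.
      rewrite (le_trans (ler_normD _ _))// /B lerD//.
        rewrite (le_trans (ler_normB _ _))// lerD// normrM ger0_norm//.
        by rewrite ler_wpM2l.
      have -> : `|8 * v * s * x| = 8 * v * (`|s| * `|x|).
        by rewrite !normrM (ger0_norm (ler0n _ 8)) (gtr0_norm v_gt0) !mulrA.
      rewrite ler_wpM2l ?(mulr_ge0 (ler0n _ 8) (ltW v_gt0))//.
      by rewrite -[leRHS]mul1r ler_pM.
    apply: le_trans sB; rewrite ler_wpM2r// ler_wpM2l//.
  apply: (@le_trans _ _ (expR (\sum_p sampling_weight Pi p * z p) ^+ n)).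
    rewrite lerXn2r// nnegrE ?expR_ge0//; apply: sumr_ge0 => p _.
    rewrite !mulr_ge0 ?expR_ge0// addr_ge0// mulr_ge0 ?(ltW v_gt0)//.
    by rewrite mulr_ge0// sqr_ge0.
  rewrite -expRM_natl -expRD ler_expR le_eqVlt; apply/orP; left; apply/eqP.
  rewrite pair_bigA/= /N (normFPi2E hPi) !mulr_sumr -big_split/= mulr_sumr -big_split/=.
  by apply: eq_bigr => -[j t] _; rewrite /a /z /=; ring.
have ma : measurable_fun setT (fun w => expR (\sum_j \sum_t a j t * clip m (eps w j t))).
  apply: measurableT_comp => //; apply: measurable_sum => j; apply: measurable_sum => t.
  by apply: measurable_funM => //; exact: (mclip (j, t)).
apply: (@le_trans _ _ (\int[P]_w ((expR (n%:R * (s * N + K1 * s ^+ 2 * N)))%:E *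
   (expR (\sum_j \sum_t a j t * clip m (eps w j t)))%:E))%E).
  apply: ge0_le_integral => //=.
  - move=> w _; rewrite lee_fin exprn_ge0//; apply: sumr_ge0 => p _.
    rewrite !mulr_ge0 ?expR_ge0// addr_ge0// mulr_ge0 ?(ltW v_gt0)//.
    by rewrite mulr_ge0// sqr_ge0.
  - apply/measurable_EFinP; apply: measurable_funX; apply: measurable_sum => p.
    apply: measurable_funM => //; apply: measurableT_comp => //.
    apply: measurable_funM => //; apply: measurable_funB => //.
    by apply: measurable_funM => //; exact: measurable_funM.
  - by apply: measurable_funeM; exact/measurable_EFinP.
  - by move=> w _; rewrite -EFinM lee_fin.
rewrite ge0_integralZl//=; last exact/measurable_EFinP.
have n0 : 0 < n%:R :> R by rewrite ltr0n.
have dT0 : 0 < (d * T)%:R :> R by rewrite ltr0n (leq_trans n_gt0).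
have npi p : n%:R * sampling_weight Pi p <= cPi.
  have : sampling_weight Pi p <= cPi / (d * T)%:R.
    rewrite -lee_fin /sampling_weight fineK; first exact: hPi_bound.
    by rewrite fin_num_measure//; exact: measurable_mx1.
  rewrite ler_pdivlMr// mulrC => h; apply: le_trans h.
  by rewrite ler_wpM2r// ler_nat.
have am j t : `|a j t| * m <= 2^-1.
  rewrite /a normrN !normrM !(ger0_norm (ler0n _ _)) (ger0_norm (sw0 _)).
  have : `|s| * (n%:R * sampling_weight Pi (j, t)) * `|D j t| * m
      <= `|s| * cPi * Dm * m.
    rewrite ler_wpM2r ?(ltW m_gt0)//; apply: ler_pM => //.
      by rewrite !mulr_ge0.
    by rewrite ler_wpM2l.
  by move: sPi; lra.
apply: le_trans (lee_wpmul2l _ (hrows am)) _; first by rewrite lee_fin expR_ge0.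
rewrite -EFinM lee_fin -expRD ler_expR.
(* One factor n Pi_jt is bounded by [cPi], the other weight rebuilds the norm: the sum is of order
   s^2 n N, the scale of the variance terms already present. *)
have : \sum_j \sum_t a j t ^+ 2 <= 4 * s ^+ 2 * n%:R * cPi * N.
  rewrite pair_bigA/= /N (normFPi2E hPi) mulr_sumr; apply: ler_sum => p _.
  rewrite /a sqrrN !exprMn -surjective_pairing.
  have -> : 2 ^+ 2 * s ^+ 2 * n%:R ^+ 2 * sampling_weight Pi p ^+ 2 * D p.1 p.2 ^+ 2
    = (4 * s ^+ 2 * n%:R) * (n%:R * sampling_weight Pi p) *
      (sampling_weight Pi p * D p.1 p.2 ^+ 2).
    by ring.
  rewrite ler_wpM2r ?(mulr_ge0 (sw0 p) (sqr_ge0 _))// ler_wpM2l//.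
  by rewrite mulr_ge0// mulr_ge0// sqr_ge0.
move=> h.
have := ler_wpM2l (mulr_ge0 (mulr_ge0 (ler0n R 4) Phi_ge0) (sqr_ge0 m)) h.
rewrite mulrDr mulrDr [X in _ <= _ + n%:R * X](_ : _ = K1 * s ^+ 2 * N +
  16 * Phi * m ^+ 2 * cPi * s ^+ 2 * N); last by rewrite /K1; ring.
rewrite mulrDr addrA lerD2l => /le_trans; apply.
by rewrite le_eqVlt; apply/orP; left; apply/eqP; ring.
Qed.

End laplace.

(** * The noise *)

Section noise_rows.
Context {R : realType} {d T : nat} {disp disp'} {Omega : measurableType disp}
  {Omega' : measurableType disp'}.
Variables (P : probability Omega R) (P' : probability Omega' R).
Variables (eps : {RV P >-> 'M[R]_(d, T)}) (Z : int -> {RV P' >-> R}) (m : R).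
Hypothesis d_gt0 : (0 < d)%N.
Hypothesis m_gt0 : 0 < m.
Hypothesis heps_mean : forall j t, ('E_P[fun w => eps w j t] = 0)%E.
Hypothesis heps_indep : independent_rvs P (fun j w => row j (eps w)).
Hypothesis heps_law : forall j, same_law P P' (fun w => row j (eps w))
  (fun w => \row_(t < T) Z (t.+1)%:Z w).
Hypothesis heps_bound : {ae P, forall w, forall j t, `|eps w j t| <= m}.

Let mrowZ : measurable_fun setT (fun w => \row_(t < T) Z (t.+1)%:Z w).
Proof.
apply: measurable_fun_mx => i t.
rewrite (_ : (fun w => _) = (Z t.+1%:Z : Omega' -> R)); first exact: measurable_funP.
by apply/funext => w; rewrite mxE.
Qed.

Let mroweps j : measurable_fun setT (fun w => row j (eps w)).
Proof. exact: measurable_row. Qed.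

Let mclip_entry (t : 'I_T) :
  measurable_fun setT (fun r : 'M[R]_(1, T) => clip m (r ord0 t)).
Proof.
by apply: measurableT_comp; [exact: measurable_clip|exact: measurable_mx_entry].
Qed.

(** The hypotheses on mean and bound concern [eps]. Equality in law of a row, which exists because
    [d] is positive, carries them to the process, and clipping is almost surely the identity on
    [eps]. *)
Lemma clip_mixing_mean0 (t : 'I_T) : \int[P']_w clip m (Z t.+1%:Z w) = 0.
Proof.
pose j := Ordinal d_gt0.
have bZ : bounded_mfun (fun w => clip m (Z t.+1%:Z w)).
  split; first by apply: measurableT_comp => //; exact: measurable_clip.
  by exists m => w; exact: clip_norm_le (ltW m_gt0).
have meps : measurable_fun setT (fun w => eps w j t).
  exact: (measurableT_comp (measurable_mx_entry _ _)).
have beps : bounded_mfun (fun w => clip m (eps w j t)).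
  split; first by apply: measurableT_comp => //; exact: measurable_clip.
  by exists m => w; exact: clip_norm_le (ltW m_gt0).
have bm := @bounded_mfun_cst R.
(* [same_law_integral] is about nonnegative functions, hence the shift by [m], cancelled at the
   end. *)
have f0 x : 0 <= clip m x + m.
  by have := clip_norm_le x (ltW m_gt0); rewrite ler_norml => /andP[? _]; lra.
have := same_law_integral (f := fun r : 'M[R]_(1, T) => (clip m (r ord0 t) + m)%:E)
  (@mroweps j) mrowZ (@heps_law j).
have -> : (\int[P]_w (clip m (row j (eps w) ord0 t) + m)%:E =
    (\int[P]_w clip m (eps w j t) + m)%:E)%E.
  under eq_integral do rewrite mxE.
  rewrite bounded_mfun_fineK; last exact: bounded_mfunD beps (bm _ _ m).
  rewrite bounded_RintegralD//; last exact: bm.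
  by rewrite bounded_Rintegral_cst.
have -> : (\int[P']_w (clip m ((\row_(t < T) Z (t.+1)%:Z w) ord0 t) + m)%:E =
    (\int[P']_w clip m (Z t.+1%:Z w) + m)%:E)%E.
  under eq_integral do rewrite mxE.
  rewrite bounded_mfun_fineK; last exact: bounded_mfunD bZ (bm _ _ m).
  rewrite bounded_RintegralD//; last exact: bm.
  by rewrite bounded_Rintegral_cst.
have -> : \int[P]_w clip m (eps w j t) = 0.
  transitivity (fine (\int[P]_w (eps w j t)%:E)%E); last first.
    by have := heps_mean j t; rewrite unlock => ->.
  congr fine; apply: ae_eq_integral => //.
  - by apply/measurable_EFinP; exact: beps.1.
  - exact/measurable_EFinP.
  - by apply: filterS heps_bound => w hw _; rewrite clip_id.
move=> h; suff : (0 + m)%:E = (\int[P']_w clip m (Z t.+1%:Z w) + m)%:E.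
  by case=> /addIr <-.
apply: h; first by apply/measurable_EFinP; apply: measurable_funD.
by move=> r; rewrite lee_fin.
Qed.

(** Each row is transferred to the process [Z], where the mixing bound applies, and the bounds
    multiply by independence of the rows. Mixing thus acts only within a row, which keeps the
    constant free of [d]. *)
Lemma rows_mgf_le (a : 'I_d -> 'I_T -> R) : (forall j t, `|a j t| * m <= 2^-1) ->
  (\int[P]_w (expR (\sum_j \sum_t a j t * clip m (eps w j t)))%:E <=
   (expR (4 * Phi_mixing P' Z T * m ^+ 2 * \sum_j \sum_t a j t ^+ 2))%:E)%E.
Proof.
move=> am.
pose g j (r : 'M[R]_(1, T)) := expR (\sum_t a j t * clip m (r ord0 t)).
have mg j : measurable_fun setT (g j).
  apply: measurableT_comp => //; apply: measurable_sum => t.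
  exact: measurable_funM.
have row_le j : (\int[P]_w (g j (row j (eps w)))%:E <=
    (expR (4 * Phi_mixing P' Z T * m ^+ 2 * \sum_t a j t ^+ 2))%:E)%E.
  rewrite (same_law_integral (f := fun r : 'M[R]_(1, T) => (g j r)%:E) (@mroweps j)
     mrowZ (@heps_law j)).
  - have -> : (\int[P']_w (g j (\row_(t < T) Z (t.+1)%:Z w))%:E =
        \int[P']_w (expR (\sum_(t < T) a j t * clip m (Z t.+1%:Z w)))%:E)%E.
      apply: eq_integral => w _; rewrite /g; congr (expR _)%:E.
      by apply: eq_bigr => t _; rewrite mxE.
    rewrite bounded_mfun_fineK.
      by rewrite lee_fin; apply: clip_mixing_mgf_le => //; exact: clip_mixing_mean0.
    apply: bounded_mfun_expR; apply: bounded_mfun_sum => t; apply: bounded_mfunZl.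
    split; first by apply: measurableT_comp => //; exact: measurable_clip.
    by exists m => w; exact: clip_norm_le (ltW m_gt0).
  - exact/measurable_EFinP.
  - by move=> r; rewrite lee_fin expR_ge0.
have := integral_prod_comp_le (P := P) (Y := fun j w => row j (eps w)) (p := 1)
  (g := g) (e := fun j => expR (4 * Phi_mixing P' Z T * m ^+ 2 * \sum_t a j t ^+ 2))
  measurableT mroweps ler01 _ mg _ row_le.
rewrite mul1r -expR_sum -mulr_sumr => h.
apply: le_trans (h _ _).
- rewrite le_eqVlt; apply/orP; left; apply/eqP; apply: eq_integral => w _.
  rewrite indicE in_setT mul1r expR_sum; congr EFin; apply: eq_bigr => j _.
  by rewrite /g; congr expR; apply: eq_bigr => t _; rewrite mxE.
- move=> B mB; rewrite setTI mul1r.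
  apply: (mutual_independence_setT heps_indep) => j.
  by exists (B j) => //; rewrite setTI.
- by move=> j r; exact: expR_ge0.
Qed.

End noise_rows.

Section noise_moments.
Context {R : realType} {disp} {Omega : measurableType disp}.
Variables (P : probability Omega R) (xi : {RV P >-> R}) (v c : R).
Hypothesis v_gt0 : 0 < v.
Hypothesis c_gt0 : 0 < c.
Hypothesis hxi_mean : ('E_P[xi] = 0)%E.
Hypothesis hxi_2 : ('E_P[fun w => (xi w ^+ 2)%R] <= v%:E)%E.
Hypothesis hxi_q : forall q : nat, (3 <= q)%N ->
  ('E_P[fun w => (`|xi w| ^+ q)%R] <= (v * c ^+ (q - 2) * q`!%:R / 2)%:E)%E.

Lemma noise_mgf_le u : `|u| * c <= 6^-1 ->
  (\int[P]_w (expR (u * xi w))%:E <= (1 + 2 * u ^+ 2 * v)%:E)%E.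
Proof.
move=> uc; apply: (mgf_le (c := c)) => //.
- exact: ltW.
- exact: ltW.
- by move: hxi_mean; rewrite unlock.
- by move: hxi_2; rewrite unlock.
- by move=> q q3; have := hxi_q q3; rewrite unlock.
Qed.

(** exp(u|x|) <= exp(ux) + exp(-ux). *)
Lemma noise_abs_mgf_le u : `|u| * c <= 6^-1 ->
  (\int[P]_w (expR (u * `|xi w|))%:E <= (2 * (1 + 2 * u ^+ 2 * v))%:E)%E.
Proof.
move=> uc.
have muxi u' : measurable_fun setT (fun w => (expR (u' * xi w))%:E).
  by apply/measurable_EFinP; apply: measurableT_comp => //; exact: measurable_funM.
apply: (@le_trans _ _ (\int[P]_w ((expR (u * xi w))%:E + (expR (- u * xi w))%:E))%E).
  apply: ge0_le_integral => //=.
  - apply/measurable_EFinP; apply: measurableT_comp => //; apply: measurable_funM => //.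
    exact: measurableT_comp.
  - exact: emeasurable_funD.
  - move=> w _; rewrite -EFinD lee_fin mulNr -mulrN.
    case: (ler0P (xi w)) => _; first by rewrite lerDr expR_ge0.
    by rewrite lerDl expR_ge0.
rewrite ge0_integralD//=.
rewrite mulrDl mul1r EFinD; apply: leeD; first exact: noise_mgf_le.
by apply: le_trans (noise_mgf_le _) _; rewrite ?normrN// sqrrN.
Qed.

End noise_moments.

(** * Net and amplification *)

Section net.
Context {R : realType}.

(** The interval [-b, b] is rescaled to [0, N]; its right end falls into the cell [N], hence [N.+1]
    cells. *)
Definition grid (b : R) (N : nat) (x : R) : 'I_N.+1 :=
  inord (Num.truncn ((x + b) / (2 * b) * N%:R)).

Lemma grid_close (b : R) N (x y : R) : 0 < b -> (0 < N)%N ->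
  `|x| <= b -> `|y| <= b -> grid b N x = grid b N y -> `|x - y| <= 2 * b / N%:R.
Proof.
move=> b0 N0 xb yb.
have b20 : 0 < 2 * b by rewrite mulr_gt0.
have N0' : 0 < N%:R :> R by rewrite ltr0n.
have range z : `|z| <= b -> 0 <= (z + b) / (2 * b) * N%:R <= N%:R.
  rewrite ler_norml => /andP[z1 z2]; apply/andP; split.
    by rewrite mulr_ge0// divr_ge0 ?(ltW b20)//; lra.
  by rewrite ler_piMl// ler_pdivrMr//; lra.
have trunc_lt z : `|z| <= b -> (Num.truncn ((z + b) / (2 * b) * N%:R) < N.+1)%N.
  move=> /range /andP[z0 zN].
  by rewrite truncn_lt_nat// (le_lt_trans zN)// ltr_nat.
move=> /(congr1 val); rewrite /= !inordK ?trunc_lt// => exy.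
have /andP[x0 _] := range _ xb; have /andP[y0 _] := range _ yb.
have := truncn_itv y0; have := truncn_itv x0; rewrite exy.
move: (Num.truncn _) => k; rewrite -[k.+1]addn1 natrD => /andP[hx1 hx2] /andP[hy1 hy2].
have -> : x - y = ((x + b) / (2 * b) * N%:R - (y + b) / (2 * b) * N%:R) * (2 * b / N%:R).
  by field; rewrite !gt_eqF.
rewrite normrM (ger0_norm (x := 2 * b / _)) ?divr_ge0 ?(ltW b20)//.
rewrite ler_piMl ?divr_ge0 ?(ltW b20)// ler_norml.
by apply/andP; split; lra.
Qed.

Lemma mulmx_entry_close d k tau (U U' : 'M[R]_(d, k)) (V V' : 'M[R]_(k, tau)) (b e : R) :
  0 <= b -> (forall j i, `|U' j i| <= b) -> (forall i l, `|V i l| <= b) ->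
  (forall j i, `|U j i - U' j i| <= e) -> (forall i l, `|V i l - V' i l| <= e) ->
  forall j l, `|(U *m V) j l - (U' *m V') j l| <= k%:R * (2 * b * e).
Proof.
move=> b0 U'b Vb Ue Ve j l; rewrite !mxE -sumrB.
apply: le_trans (ler_norm_sum _ _ _) _.
apply: (@le_trans _ _ (\sum_(i < k) 2 * b * e)); last first.
  by rewrite sumr_const card_ord [leRHS]mulr_natl.
apply: ler_sum => i _.
have -> : U j i * V i l - U' j i * V' i l =
  (U j i - U' j i) * V i l + U' j i * (V i l - V' i l) by ring.
apply: le_trans (ler_normD _ _) _; rewrite !normrM.
have := ler_pM (normr_ge0 _) (normr_ge0 _) (Ue j i) (Vb i l).
have := ler_pM (normr_ge0 _) (normr_ge0 _) (U'b j i) (Ve i l).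
lra.
Qed.

(* The cells cover the factors; each cell that meets S is represented by an
   element of S, the others by A0. *)
Lemma factor_class_net d k tau (b : R) N (S : set 'M[R]_(d, tau)) A0 :
  0 < b -> (0 < N)%N -> S A0 -> S `<=` factor_class d k tau b ->
  exists2 A : {ffun 'I_d * 'I_k -> 'I_N.+1} * {ffun 'I_k * 'I_tau -> 'I_N.+1} ->
              'M[R]_(d, tau),
    (forall c, S (A c)) &
    forall M, S M -> exists c, forall j l,
      `|A c j l - M j l| <= k%:R * (2 * b * (2 * b / N%:R)).
Proof.
move=> b0 N0 SA0 hS.
pose in_cell (c : {ffun 'I_d * 'I_k -> 'I_N.+1} * {ffun 'I_k * 'I_tau -> 'I_N.+1})
    (M : 'M[R]_(d, tau)) := exists (U : 'M[R]_(d, k)) (V : 'M[R]_(k, tau)),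
  [/\ M = U *m V, forall j l, `|U j l| <= b, forall l t, `|V l t| <= b,
      c.1 = [ffun p => grid b N (U p.1 p.2)] & c.2 = [ffun p => grid b N (V p.1 p.2)]].
have /choice[A hA] : forall c, exists M, S M /\
    ((exists2 M', S M' & in_cell c M') -> in_cell c M).
  move=> c; have [[M SM cM]|no] := pselect (exists2 M', S M' & in_cell c M').
    by exists M.
  by exists A0; split => // h; exfalso; exact: no h.
exists A => [c|M SM]; first exact: (hA c).1.
have [U [V [MUV Ub Vb]]] := hS _ SM.
exists ([ffun p => grid b N (U p.1 p.2)], [ffun p => grid b N (V p.1 p.2)]).
set c := (_, _).
have [|U' [V' [-> U'b V'b cU cV]]] := (hA c).2.
  by exists M => //; exists U, V.
move=> j l; rewrite MUV; apply: mulmx_entry_close => //; first exact: ltW.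
- move=> j' i; apply: grid_close => //.
  by have /ffunP/(_ (j', i)) := cU; rewrite !ffunE.
- move=> i l'; apply: grid_close => //.
  by have /ffunP/(_ (i, l')) := cV; rewrite !ffunE.
Qed.

Lemma card_net d k tau N :
  #|{: {ffun 'I_d * 'I_k -> 'I_N.+1} * {ffun 'I_k * 'I_tau -> 'I_N.+1}}| =
  (N.+1 ^ (k * (d + tau)))%N.
Proof.
by rewrite card_prod !card_ffun !card_prod !card_ord -expnD mulnDr [(d * k)%N]mulnC.
Qed.

End net.

Section amplification.
Context {R : realType} {d tau T : nat}.
Variables (Lambda : 'M[R[i]]_(tau, T)) (mL : R).
Hypothesis hmL : (amplification d Lambda <= mL%:E)%E.

Lemma amplification_ge1 : 1 <= mL.
Proof. by rewrite -lee_fin; apply: le_trans hmL; rewrite /amplification le_max lexx. Qed.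

(** [A] is real, so the real part can be taken in [Lambda] alone; linearity and measurability in [A]
    follow. *)
Lemma mul_realE m (A : 'M[R]_(m, tau)) :
  mul_real Lambda A = A *m map_mx (@complex.Re R) Lambda.
Proof.
apply/matrixP => j t; rewrite !mxE raddf_sum; apply: eq_bigr => l _.
by rewrite !mxE; case: (Lambda l t) => x y /=; rewrite mul0r subr0.
Qed.

Lemma mul_realB m (A A' : 'M[R]_(m, tau)) :
  mul_real Lambda (A - A') = mul_real Lambda A - mul_real Lambda A'.
Proof. by rewrite !mul_realE mulmxBl. Qed.

Lemma mx_norm_entry m n (A : 'M[R]_(m, n)) i j : `|A i j| <= mx_norm A.
Proof. by rewrite mx_normrE; exact: (le_bigmax 0 (fun p => `|A p.1 p.2|) (i, j)). Qed.

Lemma mx_norm_le m n (A : 'M[R]_(m, n)) r : 0 <= r ->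
  (forall i j, `|A i j| <= r) -> mx_norm A <= r.
Proof. by move=> r0 h; rewrite mx_normrE; apply: bigmax_le. Qed.

Lemma Re_le_normc (z : R[i]) : `|complex.Re z| <= ComplexField.Normc.normc z.
Proof.
case: z => x y /=; rewrite -sqrtr_sqr ler_wsqrtr// lerDl; exact: sqr_ge0.
Qed.

(** Used with [r] proportional to m0 / mL, so that [mL] cancels and the resulting bounds depend on
    [m0] only. *)
Lemma mul_real_entry_le (A : 'M[R]_(d, tau)) r : 0 <= r -> (forall j l, `|A j l| <= r) ->
  forall j t, `|mul_real Lambda A j t| <= mL * r.
Proof.
move=> r0 hA j t; have mL0 : 0 <= mL := le_trans ler01 amplification_ge1.
have [->|A0] := eqVneq A 0; first by rewrite mul_realE mul0mx mxE normr0 mulr_ge0.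
have nA0 : 0 < mx_norm A.
  rewrite lt_neqAle mx_normrE bigmax_ge_id andbT eq_sym -mx_normrE.
  by apply: contra A0 => /eqP/mx_norm_eq0 ->.
have : mx_normC (mul_cplx Lambda A) / mx_norm A <= mL.
  rewrite -lee_fin; apply: le_trans hmL; rewrite /amplification le_max; apply/orP; right.
  by apply: ereal_sup_ubound; exists A.
rewrite ler_pdivrMr// => h.
apply: (@le_trans _ _ (mL * mx_norm A)); last first.
  by rewrite ler_wpM2l// mx_norm_le.
apply: le_trans h; rewrite /mx_normC.
apply: le_trans (mx_norm_entry _ j t).
rewrite /mul_real !mxE; apply: le_trans (ler_norm _).
exact: Re_le_normc.
Qed.

End amplification.

(** * Combining the bounds *)

Section markov.
Context {R : realType} {d} {Omega : measurableType d} (P : probability Omega R).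

(** [E], a null set and the event W >= a cover the space, and Markov bounds the last one by M/a <
    alpha. *)
Lemma markov_prob_gt (W : Omega -> R) (E : set Omega) (M a alpha : R) :
  measurable_fun setT W -> (forall w, 0 <= W w) ->
  (\int[P]_w (W w)%:E <= M%:E)%E -> 0 < a -> M < a * alpha ->
  measurable E -> {ae P, forall w, W w < a -> E w} ->
  ((1 - alpha)%:E < P E)%E.
Proof.
move=> mW W0 EW a0 Ma mE [N [mN PN hN]].
pose G := [set w | a <= W w].
have mG : measurable G.
  have -> : G = W @^-1` `[a, +oo[%classic.
    by apply/seteqP; split => w /=; rewrite in_itv/= andbT.
  by rewrite -[X in measurable X]setTI; exact: mW.
have mENG : measurable (E `|` N `|` G).
  by apply: measurableU => //; exact: measurableU.
have cover : E `|` N `|` G = setT.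
  apply/seteqP; split => // w _; have [Ww|] := ltP (W w) a; last by right.
  by left; have [Ew|nEw] := pselect (E w); [left|right; apply: hN => /= /(_ Ww)].
have PG : (a%:E * P G <= M%:E)%E.
  apply: le_trans EW; apply: (@le_trans _ _ (\int[P]_(w in G) (W w)%:E)%E).
    rewrite -(integral_cst P mG a%:E); apply: ge0_le_integral => //=.
    - by move=> w _; rewrite lee_fin ltW.
    - by apply/measurable_EFinP; exact: measurable_funTS.
  apply: ge0_subset_integral => //; first exact/measurable_EFinP.
  by move=> w _; rewrite lee_fin.
have : (1 <= P E + P G)%E.
  rewrite -(probability_setT P) -cover.
  apply: le_trans (measureU2 _ _ _) _ => //; first exact: measurableU.
  apply: leeD2r; apply: le_trans (measureU2 _ _ _) _ => //.
  by have /= -> := PN; rewrite adde0.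
rewrite -[P E]fineK ?fin_num_measure// -[P G in X in X -> _]fineK ?fin_num_measure//.
rewrite -EFinD lee_fin lte_fin => h.
move: PG; rewrite -[P G]fineK ?fin_num_measure// -EFinM lee_fin => PG.
have : fine (P G) < alpha by rewrite -(ltr_pM2l a0) (le_lt_trans PG).
lra.
Qed.

End markov.

(** exp(1/2) <= 1 + 1/2 + 2/4 = 2, then square. This gives 1 <= log(4/alpha), which absorbs the
    additive constants. *)
Lemma expR1_le4 {R : realType} : expR 1 <= 4 :> R.
Proof.
rewrite (_ : expR 1 = expR 2^-1 * expR 2^-1); last first.
  by rewrite -expRD; congr expR; lra.
have e0 := @expR_ge0 R 2^-1; have := @expR_le_1D2sqr R 2^-1 (lexx _).
by move: (expR _) e0 => e e0 h; nra.
Qed.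

(* The inverse of the sum of the reciprocals of the upper bounds imposed on s. *)
Definition rate_s {R : realType} (m0 v c m Phi cPi : R) : R :=
  let Dm := 2 * m0 in let B := Dm + 2 * m + 8 * v * Dm in
  (1 + 2 * (Dm * B) + 12 * (Dm * c) + 4 * (cPi * Dm * m)
   + 2 * (8 * v + 2 * B ^+ 2 + 16 * Phi * m ^+ 2 * cPi))^-1.

(* Bounds [ln E exp(u |xi|)] at [u = 1 / (6 c)]. *)
Definition log_abs_mgf {R : realType} (v c : R) : R :=
  ln (2 * (1 + 2 * (6 * c)^-1 ^+ 2 * v)).

(** The outer 2 undoes the factor 1/2 in front of the excess risk, and [3 / rate_s] comes from
    dividing the exponents by s. The other terms are the price of the net: bounded quantities first,
    then the sum of the |xi_i|. *)
Definition risk_const {R : realType} (m0 v c m mL Phi cPi : R) : R :=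
  2 * (3 / rate_s m0 v c m Phi cPi + 24 * m0 ^+ 2 + 8 * m0 * m
       + 8 * m0 * ((log_abs_mgf v c + 1) * (6 * c))).

Section rate.
Context {R : realType} (m0 v c m Phi cPi : R).
Hypotheses (m0_gt0 : 0 < m0) (v_gt0 : 0 < v) (c_gt0 : 0 < c) (m_gt0 : 0 < m)
  (Phi_ge0 : 0 <= Phi) (cPi_gt0 : 0 < cPi).
Let Dm := 2 * m0.
Let B := Dm + 2 * m + 8 * v * Dm.
Let K := 8 * v + 2 * B ^+ 2 + 16 * Phi * m ^+ 2 * cPi.
Let s := rate_s m0 v c m Phi cPi.

Lemma rate_sP : [/\ 0 < s <= 1, s * Dm * B <= 2^-1, 12 * s * Dm * c <= 1,
  4 * s * cPi * Dm * m <= 1 & s * K <= 2^-1].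
Proof.
have Dm0 : 0 < Dm by rewrite mulr_gt0.
have B0 : 0 < B by rewrite !addr_gt0// !mulr_gt0.
have x1 : 0 < Dm * B by rewrite mulr_gt0.
have x2 : 0 < Dm * c by rewrite mulr_gt0.
have x3 : 0 < cPi * Dm * m by rewrite !mulr_gt0.
have x4 : 0 < K.
  rewrite /K ltr_wpDr//; first by rewrite mulr_ge0 ?(ltW cPi_gt0)// mulr_ge0 ?sqr_ge0// mulr_ge0.
  by rewrite ltr_wpDr ?mulr_gt0// mulr_ge0// sqr_ge0.
have sE : s = (1 + 2 * (Dm * B) + 12 * (Dm * c) + 4 * (cPi * Dm * m) + 2 * K)^-1 by [].
set q := 1 + _ + _ + _ + _ in sE.
have q0 : 0 < q by rewrite /q; lra.
have s0 : 0 < s by rewrite sE invr_gt0.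
have small y : y <= q -> s * y <= 1.
  by move=> yq; rewrite sE mulrC ler_pdivrMr// mul1r.
split=> //.
- by rewrite s0/=; have := small 1; rewrite mulr1; apply; rewrite /q; lra.
- have : s * (2 * (Dm * B)) <= 1 by apply: small; rewrite /q; lra.
  by rewrite (_ : s * (2 * (Dm * B)) = 2 * (s * Dm * B)); [lra|ring].
- by rewrite (_ : 12 * s * Dm * c = s * (12 * (Dm * c))); [apply: small; rewrite /q; lra|ring].
- rewrite (_ : 4 * s * cPi * Dm * m = s * (4 * (cPi * Dm * m))); last by ring.
  by apply: small; rewrite /q; lra.
- have : s * (2 * K) <= 1 by apply: small; rewrite /q; lra.
  by lra.
Qed.

Lemma log_abs_mgf_ge0 : 0 <= log_abs_mgf v c.
Proof.
rewrite ln_ge0//; have : 0 <= (6 * c)^-1 ^+ 2 * v by rewrite mulr_ge0 ?sqr_ge0 ?ltW.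
lra.
Qed.

(** Suffixes h, c, s stand for the estimator, its net point and the oracle; N is the squared norm, Z
    the excess loss, [nu] the sample size, [X] the sum of |xi_i|, [lC] the logarithm of the net
    size, L = k(d+tau) log n, l = log(4/alpha). The chain is Nh, Nc, Zc, Zh, Zs, Ns, by the net, the
    Laplace bound at -s, the net, minimality, and the Laplace bound at +s. *)
Lemma risk_bound_combine (mL nu Nh Nc Ns Zh Zc Zs X l L lC : R) :
  1 <= nu -> 1 <= l -> 0 <= L -> 0 <= X -> lC <= 2 * L + l ->
  Zh <= Zs ->
  s * (nu / 2 * Nc - Zc) <= lC + l ->
  s * (Zs - 3 / 2 * nu * Ns) <= l ->
  (6 * c)^-1 * X <= nu * log_abs_mgf v c + l ->
  Zc - Zh <= 4 * m0 * (2 * Dm + 2 * m) + 8 * m0 / nu * X ->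
  Nh <= Nc + 4 * m0 / nu * (2 * Dm) ->
  Nh <= 3 * Ns + risk_const m0 v c m mL Phi cPi * (L / nu + nu^-1 * l).
Proof.
move=> nu1 l1 L0 X0 hlC hZ h1 h2 h3 h4 h5.
have [/andP[s0 _] _ _ _ _] := rate_sP.
have nu0 : 0 < nu := lt_le_trans ltr01 nu1.
have q0 := log_abs_mgf_ge0; set q := log_abs_mgf v c in h3 q0 *.
(* The mesh 1/nu compensates the [nu] summands of [X]; nu >= 1 and l >= 1 give nu q + l <= nu (q +
   1) l. *)
have hX : 8 * m0 / nu * X <= 8 * m0 * ((q + 1) * (6 * c)) * l.
  have : X <= (nu * q + l) * (6 * c).
    by rewrite -ler_pdivrMr ?mulr_gt0// mulrC.
  rewrite -!mulrA !ler_pM2l//.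
  rewrite ler_pdivrMl// => /le_trans; apply.
  rewrite (_ : nu * ((q + 1) * (6 * (c * l))) = (nu * (q + 1) * l) * (6 * c)); last by ring.
  rewrite ler_wpM2r ?(mulr_ge0 (ler0n _ 6) (ltW c_gt0))//.
  have : nu * q <= nu * q * l by rewrite ler_peMr// mulr_ge0// ltW.
  have : l <= nu * l by rewrite ler_peMl// (le_trans ler01).
  lra.
rewrite -(ler_pM2l nu0).
rewrite mulrDr [X in _ <= _ + X](_ : _ = risk_const m0 v c m mL Phi cPi * (L + l)); last first.
  by field; rewrite gt_eqF.
have i0 : 0 < s^-1 by rewrite invr_gt0.
have h1' : nu / 2 * Nc - Zc <= s^-1 * (2 * L + 2 * l).
  rewrite ler_pdivlMl//; lra.
have h2' : Zs - 3 / 2 * nu * Ns <= s^-1 * l.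
  by rewrite ler_pdivlMl.
have h5' : nu / 2 * Nh <= nu / 2 * Nc + 4 * m0 * Dm.
  have : nu / 2 * Nh <= nu / 2 * (Nc + 4 * m0 / nu * (2 * Dm)).
    by rewrite ler_pM2l// divr_gt0.
  by rewrite (_ : nu / 2 * (Nc + _) = nu / 2 * Nc + 4 * m0 * Dm)//; field; rewrite gt_eqF.
rewrite /risk_const -/s.
have e1 : 0 <= s^-1 * L by rewrite mulr_ge0// ltW.
have e2 : 0 <= s^-1 * l by rewrite mulr_ge0 ?(ltW i0)// (le_trans ler01).
have e3 : 24 * m0 ^+ 2 + 8 * m0 * m <= (24 * m0 ^+ 2 + 8 * m0 * m) * l.
  by rewrite ler_peMr// addr_ge0// !mulr_ge0 ?(ltW m0_gt0) ?(ltW m_gt0).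
have e4 : 0 <= (24 * m0 ^+ 2 + 8 * m0 * m + 8 * m0 * ((q + 1) * (6 * c))) * L.
  rewrite mulr_ge0// !addr_ge0 ?mulr_ge0 ?(ltW m0_gt0) ?(ltW m_gt0) ?(ltW c_gt0)//.
  exact: addr_ge0.
have -> : 2 * (3 / s + 24 * m0 ^+ 2 + 8 * m0 * m + 8 * m0 * ((q + 1) * (6 * c))) * (L + l) =
  2 * (3 * (s^-1 * L) + 3 * (s^-1 * l) +
   (24 * m0 ^+ 2 + 8 * m0 * m) * l + 8 * m0 * ((q + 1) * (6 * c)) * l +
   (24 * m0 ^+ 2 + 8 * m0 * m + 8 * m0 * ((q + 1) * (6 * c))) * L) by ring.
have e5 : 4 * m0 * (2 * Dm + 2 * m) + 4 * m0 * Dm = 24 * m0 ^+ 2 + 8 * m0 * m.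
  by rewrite /Dm; ring.
rewrite mulrDr in h1'.
lra.
Qed.

End rate.

Section integral_bounds.
Context {R : realType} {d} {Omega : measurableType d} (P : probability Omega R).
Implicit Types f g : Omega -> R.

Lemma integral_le_add f g (a b : R) : measurable_fun setT f -> measurable_fun setT g ->
  (forall w, 0 <= f w) -> (forall w, 0 <= g w) ->
  (\int[P]_w (f w)%:E <= a%:E)%E -> (\int[P]_w (g w)%:E <= b%:E)%E ->
  (\int[P]_w (f w + g w)%:E <= (a + b)%:E)%E.
Proof.
move=> mf mg f0 g0 fa gb; under eq_integral do rewrite EFinD.
rewrite ge0_integralD//.
- by rewrite EFinD leeD.
- by move=> w _; rewrite lee_fin.
- exact/measurable_EFinP.
- by move=> w _; rewrite lee_fin.
- exact/measurable_EFinP.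
Qed.

Lemma integral_le_scale f (k a : R) : measurable_fun setT f -> (forall w, 0 <= f w) ->
  0 <= k -> (\int[P]_w (f w)%:E <= a%:E)%E -> (\int[P]_w (k * f w)%:E <= (k * a)%:E)%E.
Proof.
move=> mf f0 k0 fa; under eq_integral do rewrite EFinM.
rewrite ge0_integralZl//.
- by rewrite EFinM lee_wpmul2l// lee_fin.
- exact/measurable_EFinP.
- by move=> w _; rewrite lee_fin.
Qed.

(** Stands in for a union bound over the net: the average keeps a mean of at most [a], and
    extracting one term later costs the cardinal. *)
Lemma integral_le_mean (I : finType) (i0 : I) (f : I -> Omega -> R) (a : R) :
  (forall i, measurable_fun setT (f i)) -> (forall i w, 0 <= f i w) ->
  (forall i, (\int[P]_w (f i w)%:E <= a%:E)%E) ->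
  (\int[P]_w (#|I|%:R^-1 * \sum_i f i w)%:E <= a%:E)%E.
Proof.
move=> mf f0 fa.
have card0 : 0 < #|I|%:R :> R by rewrite ltr0n; apply/card_gt0P; exists i0.
rewrite (_ : a = #|I|%:R^-1 * (#|I|%:R * a)); last by rewrite mulrA mulVf ?mul1r ?gt_eqF.
apply: integral_le_scale.
- by apply: measurable_sum => i; exact: mf.
- by move=> w; apply: sumr_ge0 => i _.
- by rewrite invr_ge0 ltW.
under eq_integral do rewrite -sumEFin.
rewrite ge0_integral_sum//.
- apply: le_trans (lee_sum _ (fun i _ => fa i)) _.
  by rewrite sumEFin sumr_const mulr_natl.
- by move=> i; exact/measurable_EFinP.
- by move=> i w _; rewrite lee_fin.
Qed.

End integral_bounds.

Lemma ae_probability1 {R : realType} {d} {Omega : measurableType d}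
    (P : probability Omega R) (A : set Omega) :
  measurable A -> P A = 1%E -> {ae P, forall w, A w}.
Proof.
move=> mA PA; exists (~` A); split; [exact: measurableC| |by []].
by rewrite /= probability_setC//; have /= -> := PA; rewrite subee.
Qed.

Lemma noise_abs_exp_le {R : realType} {n} {d} {Omega : measurableType d}
    (P : probability Omega R) (xi : 'I_n -> {RV P >-> R}) (u q : R) :
  independent_rvs P xi ->
  (forall i, \int[P]_w (expR (u * `|xi i w|))%:E <= q%:E)%E ->
  (\int[P]_w (expR (u * \sum_i `|xi i w|))%:E <= (q ^+ n)%:E)%E.
Proof.
move=> ind hq.
have := integral_prod_comp_le (P := P) (Y := fun i w => xi i w) (p := 1)
  (g := fun _ y => expR (u * `|y|)) (e := fun=> q) measurableT _ ler01 _ _ _ hq.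
rewrite mul1r prodr_const card_ord => h; apply: le_trans (h _ _ _ _).
- rewrite le_eqVlt; apply/orP; left; apply/eqP; apply: eq_integral => w _.
  by rewrite indicE in_setT mul1r mulr_sumr expR_sum.
- by [].
- move=> B mB; rewrite setTI mul1r; apply: (mutual_independence_setT ind) => i.
  by exists (B i) => //; rewrite setTI.
- by move=> i; apply: measurableT_comp => //; apply: measurable_funM => //; exact: measurableT_comp.
- by move=> i y; exact: expR_ge0.
Qed.

Section sample_loss.
Context {R : realType} {d T n : nat} {disp} {Omega : measurableType disp}.
Variables (P : probability Omega R) (X : 'I_n -> {RV P >-> 'M[R]_(d, T)})
  (xi : 'I_n -> {RV P >-> R}) (eps : {RV P >-> 'M[R]_(d, T)}).
Variables (w : Omega) (x : {ffun 'I_n -> 'I_d * 'I_T}) (m : R).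
Hypothesis hx : forall i, X i w = delta_mx (x i).1 (x i).2.
Hypothesis heps : forall j t, `|eps w j t| <= m.

(** n times the empirical risk at Theta0 + D minus that at Theta0, written at the sampled positions
    [x], with [eps + xi] as the noise. *)
Definition excess_loss (D : 'M[R]_(d, T)) : R :=
  \sum_i (D (x i).1 (x i).2 ^+ 2
    - 2 * (eps w (x i).1 (x i).2 + xi i w) * D (x i).1 (x i).2).

Lemma expR_excess_loss_le s D :
  expR (s * excess_loss D) <= tilted_loss X xi eps m s D w.
Proof.
rewrite /tilted_loss (bigD1 x)//= indicE mem_set; last by move=> i _; exact: hx.
rewrite mul1r /excess_loss mulr_sumr.
rewrite [leLHS](_ : _ = expR (\sum_i s * (D (x i).1 (x i).2 ^+ 2 -
    2 * (clip m (eps w (x i).1 (x i).2) + xi i w) * D (x i).1 (x i).2))).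
  by rewrite lerDl; apply: sumr_ge0 => y _; rewrite mulr_ge0 ?expR_ge0// indicE.
by congr expR; apply: eq_bigr => i _; rewrite clip_id.
Qed.

Lemma empirical_risk_excess (M0 A : 'M[R]_(d, T)) :
  empirical_risk (X^~ w) (fun i => observation (M0 + eps w) (X i w) (xi i w)) A =
  n%:R^-1 * (\sum_i (eps w (x i).1 (x i).2 + xi i w) ^+ 2 + excess_loss (A - M0)).
Proof.
rewrite /empirical_risk /excess_loss -big_split/=; congr (_ * _).
apply: eq_bigr => i _; rewrite /observation -/(frob _ _) hx !frob_delta !mxE.
ring.
Qed.

(** The difference of two terms factors as (a - b)(a + b - 2(eps + xi)). Since [xi] is unbounded,
    its absolute values remain. *)
Lemma excess_loss_close (D D' : 'M[R]_(d, T)) (Dm e : R) :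
  0 <= e -> (forall j t, `|D j t| <= Dm) -> (forall j t, `|D' j t| <= Dm) ->
  (forall j t, `|D j t - D' j t| <= e) ->
  excess_loss D - excess_loss D' <=
  n%:R * (e * (2 * Dm + 2 * m)) + 2 * e * \sum_i `|xi i w|.
Proof.
move=> e0 hD hD' hDD; rewrite /excess_loss -sumrB.
apply: (@le_trans _ _ (\sum_(i < n) (e * (2 * Dm + 2 * m) + 2 * e * `|xi i w|))).
  apply: ler_sum => i _; move: (hD (x i).1 (x i).2) (hD' (x i).1 (x i).2)
    (hDD (x i).1 (x i).2) (heps (x i).1 (x i).2).
  move: (D _ _) (D' _ _) (eps _ _ _) (xi i w) => a b c y ha hb hab hc.
  have -> : a ^+ 2 - 2 * (c + y) * a - (b ^+ 2 - 2 * (c + y) * b) =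
    (a - b) * (a + b - 2 * (c + y)) by ring.
  apply: le_trans (ler_norm _) _; rewrite normrM.
  have -> : e * (2 * Dm + 2 * m) + 2 * e * `|y| = e * (Dm + Dm + 2 * (m + `|y|)) by ring.
  apply: ler_pM => //; apply: le_trans (ler_normB _ _) _; apply: lerD.
    by apply: le_trans (ler_normD _ _) _; exact: lerD.
  rewrite normrM ger0_norm// ler_wpM2l//.
  by apply: le_trans (ler_normD _ _) _; exact: lerD.
by rewrite big_split/= sumr_const card_ord [n%:R * _]mulr_natl mulr_sumr.
Qed.

End sample_loss.

Lemma normFPi2_ge0 {R : realType} {d T} (Pi : probability 'M[R]_(d, T) R) A :
  0 <= normFPi2 Pi A.
Proof. by apply: Rintegral_ge0 => X _; exact: sqr_ge0. Qed.

Lemma measurable_sublevel {R : realType} {d} {Omega : measurableType d}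
    (f : Omega -> R) (C : R) :
  measurable_fun setT f -> measurable [set w | f w <= C].
Proof.
move=> mf; have -> : [set w | f w <= C] = f @^-1` `]-oo, C]%classic.
  by apply/seteqP; split => w /=; rewrite in_itv.
by rewrite -[X in measurable X]setTI; exact: mf.
Qed.

Lemma measurable_normFPi2 {R : realType} {d T} {disp} {Omega : measurableType disp}
    (Pi : probability 'M[R]_(d, T) R) (f : Omega -> 'M[R]_(d, T)) :
  Pi sampling_set = 1%E -> measurable_fun setT f ->
  measurable_fun setT (fun w => normFPi2 Pi (f w)).
Proof.
move=> hPi mf; under eq_fun do rewrite (normFPi2E hPi).
apply: measurable_sum => p; apply: measurable_funM => //.
apply: measurable_funX; exact: (measurableT_comp (measurable_mx_entry _ _)).
Qed.

Lemma normFPi2_close {R : realType} {d T} (Pi : probability 'M[R]_(d, T) R)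
    (D D' : 'M[R]_(d, T)) (Dm e : R) : Pi sampling_set = 1%E ->
  0 <= e -> (forall j t, `|D j t| <= Dm) -> (forall j t, `|D' j t| <= Dm) ->
  (forall j t, `|D j t - D' j t| <= e) ->
  normFPi2 Pi D' <= normFPi2 Pi D + e * (2 * Dm).
Proof.
move=> hPi e0 hD hD' hDD; rewrite !(normFPi2E hPi).
have -> : e * (2 * Dm) = \sum_p sampling_weight Pi p * (e * (2 * Dm)).
  by rewrite -mulr_suml sampling_weight_sum// mul1r.
rewrite -big_split/=.
apply: ler_sum => p _; rewrite -mulrDr ler_wpM2l ?sampling_weight_ge0//.
rewrite -lerBlDl.
have -> : D' p.1 p.2 ^+ 2 - D p.1 p.2 ^+ 2 =
  (D' p.1 p.2 - D p.1 p.2) * (D' p.1 p.2 + D p.1 p.2) by ring.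
apply: le_trans (ler_norm _) _; rewrite normrM ler_pM//; first by rewrite distrC.
by rewrite (le_trans (ler_normD _ _))// mulr_natl mulr2n lerD.
Qed.

(* For [n = 1] the logarithm of [n] vanishes: then d = tau = k = 1 and the term
   [ln (4 / alpha)] pays for the net. *)
Lemma log_card_net_le {R : realType} (d tau k n : nat) (alpha : R) :
  0 < alpha < 1 -> (0 < d)%N -> (0 < tau)%N -> (0 < n)%N -> (k <= d)%N ->
  (maxn d tau <= n)%N ->
  ln ((n.+1 ^ (k * (d + tau)))%N%:R : R) <=
  2 * (k%:R * (d + tau)%:R * ln n%:R) + ln (4 / alpha).
Proof.
move=> /andP[a0 a1] d0 tau0 n0 kd; rewrite geq_max => /andP[dn taun].
have l4 : ln (4 : R) <= ln (4 / alpha).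
  rewrite ler_ln ?posrE ?divr_gt0// ler_pdivlMr//; lra.
have [n2|] := leqP 2 n; last first.
  rewrite ltnS => n1; have {}n1 : n = 1%N by lia.
  have -> : n%:R = 1 :> R by rewrite n1.
  rewrite ln1 mulr0 mulr0 add0r; apply: le_trans l4.
  rewrite ler_ln ?posrE ?ltr0n ?expn_gt0//.
  rewrite (_ : 4 = (2 ^ 2)%N%:R)// ler_nat n1 leq_exp2l//.
  have d1 : d = 1%N by lia.
  have t1 : tau = 1%N by lia.
  by rewrite d1 t1; lia.
rewrite natrX lnXn ?ltr0n//.
(* n + 1 <= n^2, which fails at n = 1. *)
have ln_n : ln (n.+1%:R : R) <= 2 * ln n%:R.
  rewrite mulr_natl -lnXn ?ltr0n// ler_ln ?posrE ?ltr0n ?exprn_gt0 ?ltr0n//.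
  by rewrite -natrX ler_nat; nia.
have l0 : 0 <= ln (4 / alpha) by apply: le_trans l4; rewrite ln_ge0//; lra.
rewrite -[leLHS]addr0 lerD// -[ln _ *+ _]mulr_natl natrM.
rewrite [leRHS](_ : _ = k%:R * (d + tau)%:R * (2 * ln n%:R)); last by ring.
by rewrite ler_wpM2l// mulr_ge0.
Qed.

Theorem theorem3p4 (R : realType) :
  (* c depends on m0, v_xi, c_xi, m_eps, m_Lambda, Phi_eps, c_Pi only *)
  exists c : R -> R -> R -> R -> R -> R -> R -> R,
  forall (d T tau n k : nat)
    (hd : (0 < d)%N) (hT : (0 < T)%N) (htau : (0 < tau <= T)%N)
    (hn : (0 < n <= d * T)%N) (hk : (0 < k <= minn d T)%N)
    (m0 v_xi c_xi m_eps c_Pi sigma_xi m_Lambda_tau : R)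
    (hm0 : 0 < m0) (hv_xi : 0 < v_xi) (hc_xi : 0 < c_xi) (hm_eps : 0 < m_eps)
    (hc_Pi : 0 < c_Pi) (hsigma_xi : 0 < sigma_xi)
    (* the deterministic matrices Lambda and T0, and the set S_{k,tau} *)
    (Lambda : 'M[R[i]]_(tau, T)) (T0 : 'M[R]_(d, tau)) (S : set 'M[R]_(d, tau))
    (hm_Lambda_tau : (amplification d Lambda <= m_Lambda_tau%:E)%E)
    (hT0_rank : \rank T0 = k)
    (hT0_bound : mx_norm T0 <= m0 / m_Lambda_tau)
    (hS : S `<=` factor_class d k tau (Num.sqrt (m0 / (k%:R * m_Lambda_tau))))
    (hreal : forall A, S A \/ A = T0 -> mul_cplx Lambda A \is a mxOver Num.real)
    (* the random elements *)
    (disp : measure_display) (Omega : measurableType disp)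
    (P : probability Omega R)
    (Pi : probability 'M[R]_(d, T) R)
    (X : 'I_n -> {RV P >-> 'M[R]_(d, T)})
    (xi : 'I_n -> {RV P >-> R})
    (eps : {RV P >-> 'M[R]_(d, T)})
    (hPi : Pi sampling_set = 1%E)
    (hX_indep : independent_rvs P X)
    (hX_law : forall i B, measurable B -> distribution P (X i) B = Pi B)
    (hxi_indep : independent_rvs P xi)
    (hxi_law : forall i i', same_law P P (xi i) (xi i'))
    (hxi_mean : forall i, ('E_P[xi i] = 0)%E)
    (hxi_sd : forall i, ('V_P[xi i] = (sigma_xi ^+ 2)%:E)%E)
    (heps_mean : forall j t, ('E_P[fun w => eps w j t] = 0)%E)
    (hindep : mutual_independence P
      (tnth [tuple sigma_family setT X; sigma_family setT xi;
                   preimage_set_system setT eps measurable]))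
    (* law and mixing of the rows of eps *)
    (disp' : measure_display) (Omega' : measurableType disp')
    (P' : probability Omega' R) (Z : int -> {RV P' >-> R})
    (heps_indep : independent_rvs P (fun j w => row j (eps w)))
    (heps_law : forall j, same_law P P' (fun w => row j (eps w))
                            (fun w => \row_(t < T) Z (t.+1)%:Z w))
    (* boundedness of eps, moments of xi *)
    (heps_bound : {ae P, forall w, forall j t, `|eps w j t| <= m_eps})
    (hxi_2 : forall i, ('E_P[fun w => (xi i w ^+ 2)%R] <= v_xi%:E)%E)
    (hxi_q : forall i (q : nat), (3 <= q)%N ->
      ('E_P[fun w => (`|xi i w| ^+ q)%R]
         <= (v_xi * c_xi ^+ (q - 2) * q`!%:R / 2)%:E)%E)
    (* sampling *)
    (hPi_bound : forall j t, (Pi [set delta_mx j t] <= (c_Pi / (d * T)%:R)%:E)%E)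
    (* the estimator, and a minimizer of the oracle term *)
    (That : {RV P >-> 'M[R]_(d, tau)})
    (hThat : forall w, argmin S
      (fun A => empirical_risk (X^~ w)
        (fun i => observation (mul_real Lambda T0 + eps w) (X i w) (xi i w))
        (mul_real Lambda A)) (That w))
    (Tstar : 'M[R]_(d, tau))
    (hTstar : argmin S (fun A => normFPi2 Pi (mul_real Lambda (A - T0))) Tstar)
    (alpha : R) (halpha : 0 < alpha < 1)
    (hn_max : (maxn d tau <= n)%N),
  ((1 - alpha)%:E <
    P [set w | (normFPi2 Pi (mul_real Lambda (That w) - mul_real Lambda T0)
         <= 3 * normFPi2 Pi (mul_real Lambda (Tstar - T0))
            + c m0 v_xi c_xi m_eps (mx_normC Lambda) (Phi_mixing P' Z T) c_Pi
              * (k%:R * (d + tau)%:R * (ln n%:R / n%:R)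
                 + n%:R^-1 * ln (4 / alpha)))%R])%E.
Proof.
exists risk_const; intros.
have /andP[a0 a1] := halpha.
have /andP[n_gt0 ndT] := hn.
have /andP[k_gt0]  := hk; rewrite leq_min => /andP[kd kT].
have /andP[tau_gt0 tauT] := htau.
pose Phi := Phi_mixing P' Z T.
have Phi_ge0 : 0 <= Phi.
  by rewrite addr_ge0//; apply: sumr_ge0 => i _; exact: sqrtr_ge0.
(* Entries of [T0] and of members of [S] are at most m0 / m_Lambda(tau), so those of (T - T0) Lambda
   are at most 2 m0. *)
pose Dm := 2 * m0.
have Dm_gt0 : 0 < Dm by rewrite mulr_gt0.
pose s := rate_s m0 v_xi c_xi m_eps Phi c_Pi.
have [/andP[s_gt0 s_le1] sB sc sPi sK] :=
  rate_sP hm0 hv_xi hc_xi hm_eps Phi_ge0 hc_Pi.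
rewrite -/s -/Dm in s_gt0 s_le1 sB sc sPi sK.
set K := _ + _ + _ in sK.
pose u := (6 * c_xi)^-1.
have u_gt0 : 0 < u by rewrite invr_gt0 mulr_gt0.
have uc : `|u| * c_xi <= 6^-1.
  by rewrite gtr0_norm// /u invfM -mulrA mulVf ?mulr1// gt_eqF.
pose q := 2 * (1 + 2 * u ^+ 2 * v_xi).
have q_gt0 : 0 < q.
  by rewrite mulr_gt0// ltr_pwDl// mulr_ge0 ?(ltW hv_xi)// mulr_ge0// sqr_ge0.
have mL1 := amplification_ge1 hm_Lambda_tau.
have mL0 : 0 < m_Lambda_tau by exact: lt_le_trans ltr01 mL1.
pose nu : R := n%:R.
have nu1 : 1 <= nu by rewrite ler1n.
have nu0 : 0 < nu by rewrite ltr0n.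
pose b := Num.sqrt (m0 / (k%:R * m_Lambda_tau)).
have b2 : b ^+ 2 = m0 / (k%:R * m_Lambda_tau).
  by rewrite sqr_sqrtr// divr_ge0 ?(ltW hm0)// mulr_ge0// ltW.
have b_gt0 : 0 < b by rewrite sqrtr_gt0 divr_gt0// mulr_gt0// ltr0n.
pose r := m0 / m_Lambda_tau.
have r0 : 0 <= r by rewrite divr_ge0 ?ltW.
pose Th A := mul_real Lambda (A - T0).
have kb2 : k%:R * b ^+ 2 = r.
  rewrite b2 /r; field; rewrite gt_eqF//= pnatr_eq0 -lt0n k_gt0//.
have S_entry A : S A -> forall j l, `|A j l| <= r.
  move=> /hS[U [V [-> Ub Vb]]] j l; rewrite mxE.
  apply: le_trans (ler_norm_sum _ _ _) _; rewrite -kb2 mulr_natl -[k in leRHS]card_ord.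
  rewrite -sumr_const; apply: ler_sum => i _.
  by rewrite normrM expr2; apply: ler_pM.
have T0_entry j l : `|T0 j l| <= r by exact: le_trans (mx_norm_entry _ _ _) hT0_bound.
have Th_le A : S A -> forall j t, `|Th A j t| <= Dm.
  move=> SA j t; rewrite (_ : Dm = m_Lambda_tau * (2 * r)); last first.
    by rewrite /Dm /r; field; rewrite gt_eqF.
  apply: (mul_real_entry_le hm_Lambda_tau); first by rewrite mulr_ge0.
  move=> j' l; rewrite !mxE (le_trans (ler_normB _ _))// mulr_natl mulr2n.
  by apply: lerD; [exact: S_entry|exact: T0_entry].
have [SM_star min_star] := hTstar.
pose J : finType :=
  ({ffun 'I_d * 'I_k -> 'I_n.+1} * {ffun 'I_k * 'I_tau -> 'I_n.+1})%type.
have [Anet SA cover] : exists2 A : J -> 'M[R]_(d, tau), (forall c, S (A c)) &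
    forall M, S M -> exists c, forall j l,
      `|A c j l - M j l| <= k%:R * (2 * b * (2 * b / n%:R)).
  exact: factor_class_net b_gt0 n_gt0 SM_star hS.
(* The net accuracy k (2b)(2b/n) is 4 k b^2 / n with k b^2 = m0 / m_Lambda(tau), and multiplication
   by Lambda costs the factor m_Lambda(tau). *)
pose e := 4 * m0 / nu.
have e_ge0 : 0 <= e by rewrite divr_ge0 ?(ltW nu0)// mulr_ge0// ltW.
have Th_cover A : S A -> exists c, forall j t, `|Th (Anet c) j t - Th A j t| <= e.
  move=> /cover[c hc]; exists c => j t.
  have -> : Th (Anet c) j t - Th A j t = mul_real Lambda (Anet c - A) j t.
    by rewrite /Th !mul_realB !mxE; ring.
  have -> : e = m_Lambda_tau * (k%:R * (2 * b * (2 * b / n%:R))).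
    rewrite (_ : k%:R * (2 * b * (2 * b / n%:R)) = 4 * (k%:R * b ^+ 2) / nu); last first.
      by rewrite /nu; field; rewrite gt_eqF.
    by rewrite kb2 /r /e; field; rewrite !gt_eqF.
  apply: (mul_real_entry_le hm_Lambda_tau).
    by rewrite !mulr_ge0 ?divr_ge0 ?(ltW b_gt0).
  by move=> j' l; have := hc j' l; rewrite !mxE.
have hmgf i u' : `|u'| * c_xi <= 6^-1 ->
    (\int[P]_w (expR (u' * xi i w))%:E <= (1 + 2 * u' ^+ 2 * v_xi)%:E)%E.
  by apply: (noise_mgf_le (c := c_xi)) => // q' hq'; exact: hxi_q.
have hrows a : (forall j t, `|a j t| * m_eps <= 2^-1) ->
    (\int[P]_w (expR (\sum_j \sum_t a j t * clip m_eps (eps w j t)))%:E <=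
     (expR (4 * Phi * m_eps ^+ 2 * \sum_j \sum_t a j t ^+ 2))%:E)%E.
  exact: (rows_mgf_le hd hm_eps heps_mean heps_indep heps_law heps_bound).
pose N A := normFPi2 Pi (Th A).
have N0 A : 0 <= N A by exact: normFPi2_ge0.
(* As s K <= 1/2, the quadratic term is at most s N / 2: the exponent is -n s N / 2 for [sg = -1]
   and 3 n s N / 2 for [sg = 1]. *)
have laplace sg A : S A -> `|sg| = 1 ->
    (\int[P]_w (tilted_loss X xi eps m_eps (sg * s) (Th A) w)%:E <=
      (expR (nu * (sg * s * N A + 2^-1 * s * N A)))%:E)%E.
  move=> SA' sg1; have ss : `|sg * s| = s by rewrite normrM sg1 mul1r gtr0_norm.
  have := laplace_le (s := sg * s) (Dm := Dm) hPi hX_indep hX_law hxi_indep hindep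
    hm_eps hc_xi hv_xi hmgf hrows hPi_bound Dm_gt0 Phi_ge0 n_gt0 ndT.
  rewrite ss => h; have {}h := h s_le1 sB sc sPi (Th A) (Th_le A SA').
  apply: le_trans h _; rewrite lee_fin ler_expR -/(N A) -/K.
  rewrite ler_wpM2l ?(ltW nu0)// lerD2l ler_wpM2r//.
  rewrite exprMn -[sg ^+ 2]real_normK ?num_real// sg1 expr1n mul1r.
  by rewrite expr2 mulrA ler_wpM2r ?(ltW s_gt0)// mulrC.
(* Each of [Wc c], [Ws] and [Wx] is an exponential divided by its own Laplace bound. *)
pose Wc c w := expR (2^-1 * nu * s * N (Anet c)) *
  tilted_loss X xi eps m_eps (-1 * s) (Th (Anet c)) w.
pose Ws w := expR (- (3 / 2 * nu * s * N Tstar)) *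
  tilted_loss X xi eps m_eps (1 * s) (Th Tstar) w.
pose Wx w := expR (- (nu * ln q)) * expR (u * \sum_i `|xi i w|).
pose W w := #|J|%:R^-1 * (\sum_c Wc c w) + Ws w + Wx w.
have mWc c : measurable_fun setT (Wc c).
  by apply: measurable_funM => //; exact: measurable_tilted_loss.
have mWs : measurable_fun setT Ws.
  by apply: measurable_funM => //; exact: measurable_tilted_loss.
have mWx : measurable_fun setT Wx.
  apply: measurable_funM => //; apply: measurableT_comp => //.
  apply: measurable_funM => //; apply: measurable_sum => i.
  exact: measurableT_comp.
have Wc0 c w : 0 <= Wc c w by rewrite mulr_ge0 ?expR_ge0 ?tilted_loss_ge0.
have Ws0 w : 0 <= Ws w by rewrite mulr_ge0 ?expR_ge0 ?tilted_loss_ge0.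
have Wx0 w : 0 <= Wx w by rewrite mulr_ge0 ?expR_ge0.
have mWn : measurable_fun setT (fun w => #|J|%:R^-1 * \sum_c Wc c w).
  by apply: measurable_funM => //; apply: measurable_sum => c; exact: mWc.
have Wn0 w : 0 <= #|J|%:R^-1 * (\sum_c Wc c w).
  by rewrite mulr_ge0 ?invr_ge0//; apply: sumr_ge0 => c _.
have EWc c : (\int[P]_w (Wc c w)%:E <= 1%:E)%E.
  have h := laplace (-1) _ (SA c); rewrite normrN1 in h.
  apply: le_trans (integral_le_scale (measurable_tilted_loss _ _ _ _ _ _)
    (tilted_loss_ge0 _ _ _ _ _ _) (expR_ge0 _) (h erefl)) _.
  rewrite lee_fin -expRD -[leRHS]expR0 ler_expR le_eqVlt; apply/orP; left; apply/eqP.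
  by field.
have EWs : (\int[P]_w (Ws w)%:E <= 1%:E)%E.
  have h := laplace 1 _ SM_star; rewrite normr1 in h.
  apply: le_trans (integral_le_scale (measurable_tilted_loss _ _ _ _ _ _)
    (tilted_loss_ge0 _ _ _ _ _ _) (expR_ge0 _) (h erefl)) _.
  rewrite lee_fin -expRD -[leRHS]expR0 ler_expR le_eqVlt; apply/orP; left; apply/eqP.
  by field.
have EWx : (\int[P]_w (Wx w)%:E <= 1%:E)%E.
  have hq i : (\int[P]_w (expR (u * `|xi i w|))%:E <= q%:E)%E.
    by apply: (noise_abs_mgf_le (c := c_xi)) => // q' hq'; exact: hxi_q.
  apply: le_trans (integral_le_scale _ _ _ (noise_abs_exp_le hxi_indep hq)) _.
  - apply: measurableT_comp => //; apply: measurable_funM => //.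
    by apply: measurable_sum => i; exact: measurableT_comp.
  - by move=> w; exact: expR_ge0.
  - exact: expR_ge0.
  by rewrite lee_fin -{2}(lnK (x := q)) ?posrE// -expRM_natl -expRD addNr expR0.
have EW : (\int[P]_w (W w)%:E <= 3%:E)%E.
  rewrite (_ : 3 = 1 + 1 + 1); last by ring.
  (* The average needs a nonempty index set; a cell covering [Tstar] is a witness. *)
  have [c0 _] := Th_cover _ SM_star.
  apply: integral_le_add => //.
  - exact: measurable_funD.
  - by move=> w; rewrite addr_ge0.
  apply: integral_le_add => //.
  by apply: integral_le_mean => //; exact: c0.
have mW : measurable_fun setT W by apply: measurable_funD => //; exact: measurable_funD.
have W0 w : 0 <= W w by rewrite !addr_ge0.
have aex : {ae P, forall w, exists x : {ffun 'I_n -> 'I_d * 'I_T},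
    forall i, X i w = delta_mx (x i).1 (x i).2}.
  have : \forall w \ae P, forall i, sampling_set (X i w).
    apply: filter_forall => i; apply: ae_probability1.
      by rewrite -[X in measurable X]setTI; apply: measurable_funP => //;
        exact: measurable_sampling_set.
    by have := hX_law i _ measurable_sampling_set; rewrite hPi.
  apply: filterS => w h.
  have /choice[y hy] : forall i, exists p : 'I_d * 'I_T, X i w = delta_mx p.1 p.2.
    by move=> i; have [j [t ->]] := h i; exists (j, t).
  by exists [ffun i => y i] => i; rewrite ffunE.
apply: (markov_prob_gt mW W0 EW (a := 4 / alpha)).
- by rewrite divr_gt0.
- by rewrite -mulrA mulVf ?mulr1 ?gt_eqF//; lra.
- have mf : measurable_fun setT (fun w =>
      normFPi2 Pi (mul_real Lambda (That w) - mul_real Lambda T0)).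
    apply: measurable_normFPi2 => //; apply: measurable_fun_mx => j t.
    rewrite (_ : (fun w => _) = fun w => \sum_l That w j l *
      map_mx (@complex.Re R) Lambda l t - mul_real Lambda T0 j t); last first.
      by apply/funext => w; rewrite mul_realE !mxE.
    apply: measurable_funB => //; apply: measurable_sum => l.
    apply: measurable_funM => //; exact: (measurableT_comp (measurable_mx_entry _ _)).
  exact: measurable_sublevel mf.
apply: filterS2 aex heps_bound => w [x hx] epsb Wlt.
have ln4 : 1 <= ln (4 / alpha).
  rewrite -[X in X <= _](@expRK R) ler_ln ?posrE ?expR_gt0 ?divr_gt0//.
  rewrite (le_trans expR1_le4)// ler_pdivlMr//; lra.
have exp_lt y : expR y <= W w -> y <= ln (4 / alpha).
  move=> h; rewrite -[y]expRK ler_ln ?posrE ?expR_gt0 ?divr_gt0//.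
  exact: le_trans h (ltW Wlt).
have [SThat min_That] := hThat w.
(* The index depends on [w], which is harmless because the average in [W] contains every index. *)
have [c hc] := Th_cover _ SThat.
have cardJ : #|J| = (n.+1 ^ (k * (d + tau)))%N by exact: card_net.
have cardJ0 : 0 < #|J|%:R :> R by rewrite cardJ ltr0n expn_gt0.
pose Zf A := excess_loss xi eps w x (Th A).
rewrite /= -mul_realB -/(Th (That w)) -/(N (That w)) -/(Th Tstar) -/(N Tstar) -/nu.
rewrite [k%:R * _ * _]mulrA.
apply: (@risk_bound_combine R m0 v_xi c_xi m_eps Phi c_Pi hm0 hv_xi hc_xi hm_eps
  Phi_ge0 hc_Pi _ nu _ (N (Anet c)) _ (Zf (That w)) (Zf (Anet c)) (Zf Tstar)
  (\sum_i `|xi i w|) _ _ (ln #|J|%:R)) => //.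
- by rewrite !mulr_ge0// ln_ge0.
- by apply: sumr_ge0.
- rewrite cardJ; exact: log_card_net_le.
(* The sum of squared noises is common to both empirical risks, so minimality compares the excess
   losses alone. *)
- have := min_That _ SM_star.
  rewrite !(empirical_risk_excess xi eps hx)// ler_pM2l ?invr_gt0// lerD2l.
  by rewrite -!mul_realB.
- rewrite -/s -lerBlDl; apply: exp_lt.
  apply: (@le_trans _ _ (#|J|%:R^-1 * \sum_c Wc c w)); last first.
    by rewrite /W -addrA lerDl addr_ge0.
  apply: (@le_trans _ _ (#|J|%:R^-1 * Wc c w)); last first.
    rewrite ler_wpM2l ?invr_ge0 ?ler0n// (bigD1 c)//= lerDl.
    by apply: sumr_ge0 => c' _.
  rewrite expRB lnK ?posrE// mulrC ler_wpM2l ?invr_ge0 ?ler0n//.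
  rewrite (_ : s * _ = 2^-1 * nu * s * N (Anet c) + -1 * s * Zf (Anet c)); last by field.
  by rewrite expRD ler_wpM2l ?expR_ge0// expR_excess_loss_le.
- rewrite -/s; apply: exp_lt.
  apply: (@le_trans _ _ (Ws w)); last first.
    by rewrite /W addrAC lerDr addr_ge0.
  rewrite (_ : s * _ = - (3 / 2 * nu * s * N Tstar) + 1 * s * Zf Tstar); last by field.
  by rewrite expRD ler_wpM2l ?expR_ge0// expR_excess_loss_le.
- rewrite -lerBlDl; apply: exp_lt.
  apply: (@le_trans _ _ (Wx w)); last by rewrite /W lerDr addr_ge0.
  by rewrite /Wx -expRD ler_expR addrC.
- have := excess_loss_close xi x epsb e_ge0 (Th_le _ (SA c)) (Th_le _ SThat) hc.
  rewrite (_ : n%:R * _ = 4 * m0 * (2 * Dm + 2 * m_eps)); last first.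
    by rewrite /e /nu; field; rewrite gt_eqF.
  by rewrite (_ : 2 * e = 8 * m0 / nu)//; rewrite /e; field; rewrite gt_eqF.
- exact: (normFPi2_close hPi e_ge0 (Th_le _ (SA c)) (Th_le _ SThat) hc).
Qed.
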